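(* There exists a universal constant $K>0$ such that the following holds. Fix a $d$-dimensional quantum state $\sigma$ and let $\gamma$ be its minimum eigenvalue. (i) For any $\theta\ge0$, if $T\ge K\cdot\max\{\frac{d}{\theta},\frac{\sqrt d}{\sqrt{\theta\gamma}}\}$, there is an algorithm which, given one copy each of unknown $d$-dimensional states $\rho_1,\dots,\rho_T$ (i.e., given $\rho_1\otimes\cdots\otimes\rho_T$), distinguishes with probability at least $0.99$ the case $D_{\chi^2}(\rho_{\mathrm{avg}}\,\|\,\sigma)\le0.99\,\theta$ from the case $D_{\chi^2}(\rho_{\mathrm{avg}}\,\|\,\sigma)>\theta$. (ii) For any $\varepsilon>0$, if $T\ge K\cdot\frac{d}{\varepsilon^2}$, there is an algorithm which, given one copy each of $\rho_1,\dots,\rho_T$, distinguishes with probability at least $0.99$ the case $\rho_{\mathrm{avg}}=\sigma$ from the case $D_{\mathrm{tr}}(\rho_{\mathrm{avg}},\sigma)>\varepsilon$. Here $\rho_{\mathrm{avg}}=\frac1T\sum_{t=1}^T\rho_t$.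
   Context: $D_{\mathrm{tr}}(\rho,\sigma)=\frac12\|\rho-\sigma\|_1$. The Bures $\chi^2$-divergence is defined as follows: write $\sigma=U\,\mathrm{diag}(q_1,\dots,q_d)\,U^\dagger$ with $U$ unitary, and let $\rho'=U^\dagger\rho U$; then $D_{\chi^2}(\rho\,\|\,\sigma)=\sum_{i,j=1}^d\frac{2}{q_i+q_j}|\rho'_{ij}|^2-1$, with conventions $0/0=0$ and $x/0=\infty$ for $x>0$. The algorithm may apply any quantum measurement to $\rho_1\otimes\cdots\otimes\rho_T$ (chosen depending on $d,\sigma$, the distance parameter, and $T$ only) and outputs accept/reject; ''distinguishes with probability at least $0.99$'' means it accepts with probability at least $0.99$ in the first case and rejects with probability at least $0.99$ in the second case. *)

(* Defs.v *)
(* mathcomp-algebra (spectral, sesquilinear) + real_closed complex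
   numbers R[i] over a realType R (mathcomp-analysis reals). *)
From HB Require Import structures.
From mathcomp Require Import all_boot all_order all_algebra.
From mathcomp Require Import complex.
From mathcomp Require Import reals.

Set Implicit Arguments.
Unset Strict Implicit.
Unset Printing Implicit Defensive.

Import Order.TTheory GRing.Theory Num.Theory.
Local Open Scope ring_scope.
Local Open Scope sesquilinear_scope.

Section QDefs.
Variable R : realType.
Local Notation C := R[i].

(* positive semidefinite: Hermitian with nonnegative quadratic form *)
Definition psdmx n (A : 'M[C]_n) : Prop :=
  A ^t* = A /\ forall x : 'rV[C]_n, 0 <= (x *m A *m x ^t*) 0 0.

(* quantum state (density matrix) *)
Definition density n (rho : 'M[C]_n) : Prop := psdmx rho /\ \tr rho = 1.

(* two-outcome measurement operator (accept element E of the POVM {E, 1-E}) *)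
Definition effect n (E : 'M[C]_n) : Prop := psdmx E /\ psdmx (1%:M - E).

(* index type of the T-fold tensor product of C^d: functions 'I_T -> 'I_d *)
Definition tens_dim (T d : nat) : nat := #|{ffun 'I_T -> 'I_d}|.

(* rho_1 (x) ... (x) rho_T, written in the product basis (enumerated by enum_val) *)
Definition tens_state T d (rho : 'I_T -> 'M[C]_d) : 'M[C]_(tens_dim T d) :=
  \matrix_(i, j) \prod_(t < T)
     rho t ((enum_val i : {ffun 'I_T -> 'I_d}) t)
           ((enum_val j : {ffun 'I_T -> 'I_d}) t).

(* probability that the measurement {E, 1-E} accepts on the state X *)
Definition accept_prob N (E X : 'M[C]_N) : C := \tr (E *m X).

Definition rho_avg T d (rho : 'I_T -> 'M[C]_d) : 'M[C]_d :=
  (T%:R)^-1 *: \sum_(t < T) rho t.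

(* trace norm: sum of singular values = sum of square roots of the
   eigenvalues of A^dagger A *)
Definition trnorm n (A : 'M[C]_n) : C :=
  \sum_(i < n) sqrtC (spectral_diag (A ^t* *m A) 0 i).

Definition Dtr n (rho sigma : 'M[C]_n) : C := 2^-1 * trnorm (rho - sigma).

(* Bures chi^2-divergence.  sigma = U diag(q) U^dagger with U := P^dagger where
   spectral_diag/spectralmx give sigma = P^-1 diag(q) P, P unitary;
   rho' = U^dagger rho U = P rho P^dagger. *)
Definition chi2 n (rho sigma : 'M[C]_n) : C :=
  let P := spectralmx sigma in
  let q := spectral_diag sigma in
  let rho' := P *m rho *m P ^t* in
  \sum_(i < n) \sum_(j < n) 2 / (q 0 i + q 0 j) * `|rho' i j| ^+ 2 - 1.

End QDefs.

(* Main.v *)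
(* Work in an eigenbasis of sigma = diag(q), write L X = (2 X_ij / (q_i + q_j))
   and let W = \sum_ij 2 / (q_i + q_j) e_ij (x) e_ji, so that
   tr (W (A (x) B)) = tr (L A * B) and chi^2 (rho || sigma) + 1 = tr (L rho * rho).
   The test thresholds the collision observable Z, the sum of W over all ordered
   pairs of distinct copies.  With b = \sum_i (rho_avg)_ii / q_i and x the
   divergence of rho_avg, the missing diagonal pairs shift the mean of Z from
   T^2 (1 + x) by at most T b.  In the Hoeffding decomposition of Z the terms
   are orthogonal on product states even though the copies are not identical,
   and the variance is at most 10 T^2 b^2 + 8 T^3 b x: both terms come from the
   operator inequality rho <= (\sum_i rho_ii / q_i) diag(q).  Since b <= d + sqrt (x d / gamma),
   the hypothesis on T makes bias and standard deviation small compared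
   with T^2 (theta + x), and Chebyshev's inequality concludes.
   For the trace distance, first apply the depolarizing channel
   rho |-> rho / 2 + 1 / (2 d) to every copy, use the chi^2 test with
   gamma = 1 / (2 d), and bound Dtr (rho_avg, sigma)^2 by the divergence after the
   channel, via Cauchy-Schwarz against the polar part of rho_avg - sigma. *)
Require Import Defs.
From HB Require Import structures.
From mathcomp Require Import all_boot all_order all_algebra.
From mathcomp Require Import complex.
From mathcomp Require Import reals.
From mathcomp Require Import ring lra.

Set Implicit Arguments.
Unset Strict Implicit.
Unset Printing Implicit Defensive.

Import Order.TTheory GRing.Theory Num.Theory.
Local Open Scope ring_scope.
Local Open Scope sesquilinear_scope.

(** * Positive matrices and states *)

Section Adjoint.
Variable C : numClosedFieldType.

Lemma adjmxE m n (A : 'M[C]_(m, n)) i j : (A ^t*) i j = (A j i)^*.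
Proof. by rewrite !mxE. Qed.

Lemma adjmxM m n p (A : 'M[C]_(m, n)) (B : 'M[C]_(n, p)) :
  (A *m B) ^t* = B ^t* *m A ^t*.
Proof. by rewrite trmx_mul map_mxM. Qed.

Lemma adjmxD m n (A B : 'M[C]_(m, n)) : (A + B) ^t* = A ^t* + B ^t*.
Proof. by rewrite linearD map_mxD. Qed.

Lemma adjmxB m n (A B : 'M[C]_(m, n)) : (A - B) ^t* = A ^t* - B ^t*.
Proof. by rewrite linearB /= map_mxB. Qed.

Lemma adjmxZ m n (a : C) (A : 'M[C]_(m, n)) : (a *: A) ^t* = a^* *: A ^t*.
Proof. by rewrite linearZ /= map_mxZ. Qed.

Lemma adjmx_sum m n (I : Type) (r : seq I) (P : pred I) (F : I -> 'M[C]_(m, n)) :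
  (\sum_(i <- r | P i) F i) ^t* = \sum_(i <- r | P i) (F i) ^t*.
Proof. by rewrite linear_sum /= map_mx_sum. Qed.

Lemma adjmx1 n : (1%:M : 'M[C]_n) ^t* = 1%:M.
Proof. by rewrite trmx1 map_mx1. Qed.

Lemma adjmx_delta m n i j : (delta_mx i j : 'M[C]_(m, n)) ^t* = delta_mx j i.
Proof. by rewrite trmx_delta map_delta_mx. Qed.

Lemma adjmx_diag n (v : 'rV[C]_n) : (diag_mx v) ^t* = diag_mx (map_mx Num.conj v).
Proof. by rewrite tr_diag_mx map_diag_mx. Qed.

Lemma hermE n (A : 'M[C]_n) i j : A ^t* = A -> A j i = (A i j)^*.
Proof. by move=> hA; rewrite -{1}hA adjmxE. Qed.

Lemma spectral_decomp n (A : 'M[C]_n) : A ^t* = A ->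
  A = (spectralmx A) ^t* *m diag_mx (spectral_diag A) *m spectralmx A.
Proof.
move=> hA; have nA : A \is normalmx by apply/normalmxP; rewrite hA.
by rewrite -(invmx_unitary (spectral_unitarymx A)); apply/orthomx_spectralP.
Qed.

Lemma spectralmx_mulmx_adj n (A : 'M[C]_n) : spectralmx A *m (spectralmx A) ^t* = 1%:M.
Proof. exact/unitarymxP/spectral_unitarymx. Qed.

Lemma spectralmx_adj_mulmx n (A : 'M[C]_n) : (spectralmx A) ^t* *m spectralmx A = 1%:M.
Proof. exact/mulmx1C/spectralmx_mulmx_adj. Qed.

Lemma spectral_diagE n (A : 'M[C]_n) : A ^t* = A ->
  spectralmx A *m A *m (spectralmx A) ^t* = diag_mx (spectral_diag A).
Proof.
move=> hA; rewrite {2}(spectral_decomp hA) !mulmxA spectralmx_mulmx_adj mul1mx.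
by rewrite -mulmxA spectralmx_mulmx_adj mulmx1.
Qed.

End Adjoint.

Section Psd.
Variable R : realType.
Local Notation C := R[i].

Lemma psd_conjugate m n (A : 'M[C]_n) (M : 'M[C]_(n, m)) :
  psdmx A -> psdmx (M ^t* *m A *m M).
Proof.
move=> [hA pA]; split; first by rewrite !adjmxM trmxCK hA mulmxA.
move=> x; have := pA (x *m M ^t*).
by rewrite adjmxM trmxCK !mulmxA.
Qed.

Lemma psd1 n : psdmx (1%:M : 'M[C]_n).
Proof.
split=> [|x]; first exact: adjmx1.
rewrite mulmx1 mxE; apply: sumr_ge0 => i _.
by rewrite adjmxE mul_conjC_ge0.
Qed.

Lemma psd_gram m n (B : 'M[C]_(n, m)) : psdmx (B *m B ^t*).
Proof. by have := psd_conjugate (B ^t*) (psd1 m); rewrite trmxCK mulmx1. Qed.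

Lemma psd_sum n (I : finType) (F : I -> 'M[C]_n) :
  (forall i, psdmx (F i)) -> psdmx (\sum_i F i).
Proof.
move=> pF; split; first by rewrite adjmx_sum; apply: eq_bigr => i _; have [] := pF i.
move=> x; rewrite mulmx_sumr mulmx_suml summxE; apply: sumr_ge0 => i _.
by have [] := pF i.
Qed.

Lemma psd_scale n (a : C) (A : 'M[C]_n) : 0 <= a -> psdmx A -> psdmx (a *: A).
Proof.
move=> a0 [hA pA]; split; first by rewrite adjmxZ hA geC0_conj.
by move=> x; rewrite -scalemxAr -scalemxAl mxE mulr_ge0.
Qed.

Lemma psdD n (A B : 'M[C]_n) : psdmx A -> psdmx B -> psdmx (A + B).
Proof.
move=> [hA pA] [hB pB]; split; first by rewrite adjmxD hA hB.
by move=> x; rewrite mulmxDr mulmxDl mxE addr_ge0.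
Qed.

Lemma psd_diag_ge0 n (A : 'M[C]_n) i : psdmx A -> 0 <= A i i.
Proof.
move=> [_ /(_ (delta_mx 0 i))]; rewrite adjmx_delta.
by rewrite -rowE -colE !mxE.
Qed.

Lemma psd_trace_ge0 n (A : 'M[C]_n) : psdmx A -> 0 <= \tr A.
Proof. by move=> pA; apply: sumr_ge0 => i _; apply: psd_diag_ge0. Qed.

Lemma psd_diag_mx n (v : 'rV[C]_n) : (forall i, 0 <= v 0 i) -> psdmx (diag_mx v).
Proof.
move=> v0; split.
  rewrite adjmx_diag; congr diag_mx; apply/rowP => i.
  by rewrite mxE geC0_conj.
move=> x; rewrite mul_mx_diag !mxE; apply: sumr_ge0 => i _.
rewrite !mxE mulrAC mulr_ge0 // mul_conjC_ge0 //.
Qed.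

Lemma psd_spectral_ge0 n (A : 'M[C]_n) i : psdmx A -> 0 <= spectral_diag A 0 i.
Proof.
move=> pA; have := psd_conjugate ((spectralmx A) ^t*) pA.
rewrite trmxCK spectral_diagE ?pA.1// => /psd_diag_ge0 => /(_ i).
by rewrite mxE eqxx mulr1n.
Qed.

(** The adjoint of the eigenbasis matrix, scaled by square roots of the eigenvalues, serves as [B].
    Gram factors pass directly to tensor products. *)
Lemma psd_factor n (A : 'M[C]_n) : psdmx A -> exists B : 'M[C]_n, A = B *m B ^t*.
Proof.
move=> pA; exists ((spectralmx A) ^t* *m diag_mx (map_mx sqrtC (spectral_diag A))).
rewrite adjmxM trmxCK adjmx_diag {1}(spectral_decomp pA.1) -!mulmxA; congr (_ *m _).
rewrite [RHS]mulmxA; congr (_ *m _); apply/matrixP => i j; rewrite mul_diag_mx !mxE.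
case: eqP => [->|_]; rewrite ?mulr0n ?mulr0 // !mulr1n.
by rewrite -normCK ger0_norm ?sqrtCK ?sqrtC_ge0 ?psd_spectral_ge0.
Qed.

Lemma density_trace1 n (A : 'M[C]_n) : density A -> \tr A = 1. Proof. by case. Qed.

Lemma density_herm n (A : 'M[C]_n) : density A -> A ^t* = A. Proof. by case=> -[]. Qed.

Lemma density_unitary n (A P : 'M[C]_n) :
  P ^t* *m P = 1%:M -> density A -> density (P *m A *m P ^t*).
Proof.
move=> hP [pA tA]; split; first by have := psd_conjugate (P ^t*) pA; rewrite trmxCK.
by rewrite mxtrace_mulC mulmxA hP mul1mx.
Qed.

Lemma density_rho_avg T d (rho : 'I_T -> 'M[C]_d) :
  (0 < T)%N -> (forall t, density (rho t)) -> density (rho_avg rho).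
Proof.
move=> T0 hr; split.
  by apply: psd_scale; [rewrite invr_ge0 ler0n | apply: psd_sum => t; have [] := hr t].
rewrite /rho_avg linearZ /= raddf_sum /= (eq_bigr (fun _ => 1)); last first.
  by move=> t _; have [] := hr t.
by rewrite sumr_const card_ord mulVf // pnatr_eq0 -lt0n.
Qed.

End Psd.

(** * Product states and effects *)

Section Tensor.
Variable R : realType.
Local Notation C := R[i].
Variables T d : nat.
Implicit Types F G : 'I_T -> 'M[C]_d.

Lemma tens_stateE F i j :
  tens_state F i j =
  \prod_(t < T) F t ((enum_val i : {ffun 'I_T -> 'I_d}) t)
                    ((enum_val j : {ffun 'I_T -> 'I_d}) t).
Proof. by rewrite mxE. Qed.

(** Matrices are indexed by ordinals, while expanding a product of sums yields functions; this moves
    between the two. *)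
Lemma big_tens_dim (V : nmodType) (f : {ffun 'I_T -> 'I_d} -> V) :
  \sum_(k < tens_dim T d) f (enum_val k) = \sum_g f g.
Proof.
rewrite [RHS](reindex (fun k : 'I_(tens_dim T d) => enum_val k : {ffun 'I_T -> 'I_d})) //=.
by exists enum_rank => x _; rewrite ?enum_valK ?enum_rankK.
Qed.

Lemma eq_tens F G : (forall t, F t = G t) -> tens_state F = tens_state G.
Proof. by move=> FG; apply/matrixP => i j; rewrite !mxE; apply: eq_bigr => t _; rewrite FG. Qed.

Lemma tensM F G : tens_state F *m tens_state G = tens_state (fun t => F t *m G t).
Proof.
apply/matrixP => i j; rewrite mxE tens_stateE.
under [RHS]eq_bigr do rewrite mxE.
rewrite bigA_distr_bigA /= -big_tens_dim.
by apply: eq_bigr => k _; rewrite !tens_stateE -big_split.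
Qed.

Lemma tens_adj F : (tens_state F) ^t* = tens_state (fun t => (F t) ^t*).
Proof.
apply/matrixP => i j; rewrite adjmxE !tens_stateE rmorph_prod.
by apply: eq_bigr => t _; rewrite adjmxE.
Qed.

Lemma tens_tr F : \tr (tens_state F) = \prod_t \tr (F t).
Proof.
rewrite /mxtrace bigA_distr_bigA /= -big_tens_dim.
by apply: eq_bigr => k _; rewrite tens_stateE.
Qed.

Lemma tens1 : tens_state (fun _ => 1%:M) = 1%:M :> 'M[C]_(tens_dim T d).
Proof.
apply/matrixP => i j; rewrite tens_stateE mxE.
under eq_bigr do rewrite mxE.
case: (eqVneq i j) => [->|nij]; first by apply: big1 => t _; rewrite eqxx.
have [t ht] : exists t, (enum_val i : {ffun 'I_T -> 'I_d}) t
                     != (enum_val j : {ffun 'I_T -> 'I_d}) t.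
  apply/existsP; apply: contraR nij; rewrite negb_exists => /forallP h.
  by apply/eqP/enum_val_inj/ffunP => t; have := h t; rewrite negbK => /eqP.
by rewrite (bigD1 t) //= (negbTE ht) mul0r.
Qed.

Lemma tens_sum (I : finType) (M : 'I_T -> I -> 'M[C]_d) :
  tens_state (fun t => \sum_k M t k) =
  \sum_(f : {ffun 'I_T -> I}) tens_state (fun t => M t (f t)).
Proof.
apply/matrixP => i j; rewrite tens_stateE summxE.
under eq_bigr do rewrite summxE.
by rewrite bigA_distr_bigA; apply: eq_bigr => f _; rewrite tens_stateE.
Qed.

Lemma tens_density F : (forall t, density (F t)) -> density (tens_state F).
Proof.
move=> hF; split; last first.
  by rewrite tens_tr; apply: big1 => t _; apply: density_trace1.
(* A Gram factor is chosen on every site; their tensor product is a Gram factor of the product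
   state. *)
have /fin_all_exists [B hB] t : exists B : 'M[C]_d, F t = B *m B ^t*.
  by apply: psd_factor; have [] := hF t.
rewrite (eq_tens hB) -tensM -tens_adj; exact: psd_gram.
Qed.

(* Heisenberg picture: an effect is pulled back along the T-fold tensor power
   of the channel with Kraus operators [M k]. *)
Lemma effect_pullback (I : finType) (M : I -> 'M[C]_d) (E : 'M[C]_(tens_dim T d)) :
  \sum_k (M k) ^t* *m M k = 1%:M -> effect E ->
  exists E' : 'M[C]_(tens_dim T d), effect E' /\
    forall F, accept_prob E' (tens_state F) =
      accept_prob E (tens_state (fun t => \sum_k M k *m F t *m (M k) ^t*)).
Proof.
move=> hM [pE pE1].
(* Kraus operators of the tensor power, one for each word of length [T] in the Kraus indices. *)
pose K (f : {ffun 'I_T -> I}) := tens_state (fun t => M (f t)).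
pose E' := \sum_f (K f) ^t* *m E *m K f.
have K1 : \sum_f (K f) ^t* *m K f = 1%:M.
  rewrite -tens1 (eq_tens (fun _ => esym hM)) tens_sum.
  by apply: eq_bigr => f _; rewrite tens_adj tensM.
exists E'; split.
  split; first by apply: psd_sum => f; apply: psd_conjugate.
  (* By [K1], the complement of [E'] is the pullback of the complement of [E]. *)
  rewrite -K1 -sumrB; apply: psd_sum => f.
  have -> : (K f) ^t* *m K f - (K f) ^t* *m E *m K f = (K f) ^t* *m (1%:M - E) *m K f.
    by rewrite mulmxBr mulmx1 mulmxBl.
  exact: psd_conjugate.
move=> F; rewrite /accept_prob tens_sum mulmx_suml mulmx_sumr !raddf_sum /=.
apply: eq_bigr => f _.
rewrite -!mulmxA mxtrace_mulC -!mulmxA; congr (\tr (E *m _)).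
by rewrite mulmxA tens_adj !tensM; apply: eq_tens => t.
Qed.

End Tensor.

(** * Chebyshev's inequality for a Hermitian observable *)

Section Chebyshev.
Variable R : realType.
Local Notation C := R[i].

Lemma psd_diag_real n (A : 'M[C]_n) i : psdmx A -> A i i = (complex.Re (A i i))%:C%C.
Proof. by move=> /(psd_diag_ge0 i) /ger0_real /RRe_real. Qed.

Lemma sum_real_complex (I : Type) (r : seq I) (P : pred I) (F : I -> R) :
  \sum_(i <- r | P i) (F i)%:C%C = (\sum_(i <- r | P i) F i)%:C%C :> C.
Proof. by rewrite rmorph_sum. Qed.

(** The diagonalised matrix is again Hermitian, so its diagonal entries are self-conjugate. *)
Lemma herm_spectral_real n (H : 'M[C]_n) i : H ^t* = H ->
  spectral_diag H 0 i = (complex.Re (spectral_diag H 0 i))%:C%C.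
Proof.
move=> hH; symmetry; apply: RRe_real.
have := congr1 (fun M : 'M_n => (M ^t*) i i) (spectral_diagE hH).
rewrite !adjmxM trmxCK hH mulmxA spectral_diagE// adjmx_diag !mxE eqxx !mulr1n => h.
by apply/CrealP.
Qed.

(* The effect is the spectral projection of [H] onto [(-oo, tau]]. *)
Lemma chebyshev_effect N (H : 'M[C]_N) (tau : R) : H ^t* = H ->
  exists E : 'M[C]_N, effect E /\ forall X, density X ->
    exists a : R, accept_prob E X = a%:C%C /\
      forall m v : R,
        complex.Re (\tr ((H - (m%:C%C)%:M) *m (H - (m%:C%C)%:M) *m X)) <= v ->
        (m < tau -> (1 - a) * (tau - m) ^+ 2 <= v) /\
        (tau < m -> a * (m - tau) ^+ 2 <= v).
Proof.
move=> hH.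
pose V := spectralmx H; pose z i := complex.Re (spectral_diag H 0 i).
pose c i : R := (z i <= tau)%R%:R.
(* Functional calculus in the eigenbasis of [H]: [Dg z] is [H] itself, and [Dg c] with the indicator
   [c] is the spectral projection. *)
pose Dg (f : 'I_N -> R) : 'M[C]_N := V ^t* *m diag_mx (\row_i (f i)%:C%C) *m V.
have VV : V *m V ^t* = 1%:M by exact: spectralmx_mulmx_adj.
have VV' : V ^t* *m V = 1%:M by exact: spectralmx_adj_mulmx.
have Dgpsd f : (forall i, 0 <= f i) -> psdmx (Dg f).
  by move=> f0; apply: psd_conjugate; apply: psd_diag_mx => i; rewrite mxE ler0c.
have DgB f g : Dg f - Dg g = Dg (fun i => f i - g i).
  rewrite /Dg -mulmxBl -mulmxBr -linearB.
  apply: (congr1 (fun v => V ^t* *m diag_mx v *m V)).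
  by apply/rowP => i; rewrite !mxE rmorphB.
have DgM f g : Dg f *m Dg g = Dg (fun i => f i * g i).
  rewrite /Dg !mulmxA -[_ *m V *m V ^t*]mulmxA VV mulmx1 -[_ *m diag_mx _ *m diag_mx _]mulmxA.
  rewrite mulmx_diag; apply: (congr1 (fun v => V ^t* *m diag_mx v *m V)).
  by apply/rowP => i; rewrite !mxE rmorphM.
have DgC (m : R) : Dg (fun=> m) = (m%:C%C)%:M.
  rewrite /Dg (_ : diag_mx _ = (m%:C%C)%:M); last first.
    by apply/matrixP => i j; rewrite !mxE.
  by rewrite mul_mx_scalar -scalemxAl VV' scalemx1.
have HE : H = Dg z.
  rewrite {1}(spectral_decomp hH); apply: (congr1 (fun v => V ^t* *m diag_mx v *m V)).
  by apply/rowP => i; rewrite mxE -herm_spectral_real.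
have trDg f X : psdmx X ->
    \tr (Dg f *m X) = (\sum_i f i * complex.Re ((V *m X *m V ^t*) i i))%:C%C.
  move=> pX; rewrite /Dg -!mulmxA mxtrace_mulC -!mulmxA mul_diag_mx /mxtrace.
  rewrite -sum_real_complex; apply: eq_bigr => i _; rewrite mxE mxE rmorphM /=.
  rewrite mulmxA; congr (_ * _); apply: psd_diag_real.
  by rewrite -{1}[V]trmxCK; apply: psd_conjugate.
exists (Dg c); split.
  split; first by apply: Dgpsd => i; rewrite ler0n.
  rewrite -[1%:M]/((1%:C%C : C)%:M) -DgC DgB; apply: Dgpsd => i; rewrite /c.
  by case: (z i <= tau); rewrite ?subrr ?subr0.
(* [p] is the probability law of the measurement of [X] in the eigenbasis of [H]; from here on the
   argument is the classical inequality. *)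
move=> X [pX tX]; pose p i := complex.Re ((V *m X *m V ^t*) i i).
have p0 i : 0 <= p i.
  rewrite -ler0c -psd_diag_real; last by rewrite -{1}[V]trmxCK; apply: psd_conjugate.
  by apply: psd_diag_ge0; rewrite -{1}[V]trmxCK; apply: psd_conjugate.
have p1 : \sum_i p i = 1.
  apply: complexI; rewrite -[RHS]tX -[in RHS](mul1mx X) -[1%:M]/((1%:C%C : C)%:M) -DgC trDg//.
  by congr (_%:C)%C; apply: eq_bigr => i _; rewrite mul1r.
exists (\sum_i c i * p i); split; first exact: trDg.
move=> m v; rewrite -DgC {1 2}HE !DgB DgM trDg// /= => hv.
split=> hm; apply: le_trans hv.
  (* Rejected eigenvalues exceed [tau], so they lie at distance at least [tau - m] from [m];
     accepted ones contribute zero on the left. *)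
  rewrite -p1 -sumrB mulr_suml; apply: ler_sum => i _; rewrite -/(p i).
  rewrite -{1}[p i]mul1r -mulrBl mulrAC ler_wpM2r//.
  rewrite /c; case: (leP (z i) tau) => hz /=; first by rewrite subrr mul0r sqr_ge0.
  rewrite subr0 mul1r; nra.
rewrite mulr_suml; apply: ler_sum => i _; rewrite -/(p i) mulrAC ler_wpM2r//.
rewrite /c; case: (leP (z i) tau) => hz /=; last by rewrite mul0r sqr_ge0.
rewrite mul1r; nra.
Qed.

End Chebyshev.

(** Test vectors supported on two coordinates, which detect the 2 x 2 principal minors. *)
Lemma form_delta2 (C : numClosedFieldType) n (A : 'M[C]_n) i j (a b : C) :
  let x : 'rV[C]_n := a *: delta_mx 0 i - b *: delta_mx 0 j in
  (x *m A *m x ^t*) 0 0 =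
  a * a^* * A i i - a * b^* * A i j - b * a^* * A j i + b * b^* * A j j.
Proof.
have dE k l : ((delta_mx 0 k : 'rV[C]_n) *m A *m (delta_mx 0 l : 'rV[C]_n) ^t*) 0 0 = A k l.
  by rewrite adjmx_delta -rowE -colE !mxE.
have mB (M N : 'M[C]_1) : (M - N) 0 0 = M 0 0 - N 0 0 by rewrite !mxE.
have mZ c (M : 'M[C]_1) : (c *: M) 0 0 = c * M 0 0 by rewrite mxE.
rewrite /= adjmxB !adjmxZ !mulmxBl !mulmxBr -!scalemxAl -!scalemxAr.
by rewrite !mB !mZ !dE; ring.
Qed.

(** * The Bures form *)

Section RealPart.
Variable R : realType.
Local Notation C := R[i].
Local Notation Re := (@complex.Re R).
Implicit Types z : C.

(** The squared modulus with values in [R] rather than [R[i]], so that all estimates take place in a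
    real field. *)
Definition nsq z : R := complex.Re z ^+ 2 + complex.Im z ^+ 2.

Lemma real_complexD (x y : R) : (x + y)%:C%C = x%:C%C + y%:C%C :> C.
Proof. exact: rmorphD. Qed.

Lemma real_complexB (x y : R) : (x - y)%:C%C = x%:C%C - y%:C%C :> C.
Proof. exact: rmorphB. Qed.

Lemma real_complexM (x y : R) : (x * y)%:C%C = x%:C%C * y%:C%C :> C.
Proof. exact: rmorphM. Qed.

Lemma real_complexX (x : R) n : (x ^+ n)%:C%C = x%:C%C ^+ n :> C.
Proof. exact: rmorphXn. Qed.

Lemma real_complex_nat n : (n%:R : R)%:C%C = n%:R :> C.
Proof. exact: rmorph_nat. Qed.

Lemma ReD z1 z2 : Re (z1 + z2) = Re z1 + Re z2.
Proof. by case: z1; case: z2. Qed.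

Lemma ReB z1 z2 : Re (z1 - z2) = Re z1 - Re z2.
Proof. by case: z1; case: z2. Qed.

Lemma Re_sum (I : Type) (r : seq I) (P : pred I) (F : I -> C) :
  Re (\sum_(i <- r | P i) F i) = \sum_(i <- r | P i) Re (F i).
Proof. exact: (big_morph Re ReD). Qed.

Lemma ReZ (a : R) z : Re (a%:C%C * z) = a * Re z.
Proof. by case: z => x y /=; rewrite mul0r subr0. Qed.

Lemma conj_real (a : R) : (a%:C%C : C)^* = a%:C%C.
Proof. exact: conjc_real. Qed.

Lemma nsqM z1 z2 : nsq (z1 * z2) = nsq z1 * nsq z2.
Proof. by case: z1 => a b; case: z2 => u v; rewrite /nsq /=; ring. Qed.

Lemma nsqJ z : nsq z^* = nsq z.
Proof. by case: z => a b; rewrite /nsq /= sqrrN. Qed.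

Lemma nsq_ge0 z : 0 <= nsq z.
Proof. by rewrite addr_ge0 ?sqr_ge0. Qed.

Lemma nsq_real (a : R) : nsq a%:C%C = a ^+ 2.
Proof. by rewrite /nsq /= expr0n addr0. Qed.

Lemma Re_sqr_le_nsq z : Re z ^+ 2 <= nsq z.
Proof. by rewrite lerDl sqr_ge0. Qed.

Lemma mul_conjC_nsq z : z * z^* = (nsq z)%:C%C.
Proof. by rewrite -normCK -add_Re2_Im2. Qed.

Lemma sqr_norm_nsq z : `|z| ^+ 2 = (nsq z)%:C%C.
Proof. by rewrite -add_Re2_Im2. Qed.

(** AM-GM without square roots and without a sign condition on [y], so that it applies to real
    parts. *)
Lemma amgm2 (y a b : R) : 0 <= a -> 0 <= b -> y ^+ 2 <= a * b -> y <= (a + b) / 2.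
Proof.
move=> a0 b0 h; have s0 : 0 <= (a + b) / 2 by lra.
case: (leP y 0) => [y0|/ltW y0]; first exact: le_trans s0.
by rewrite -ler_sqr ?nnegrE//; have := sqr_ge0 (a - b); lra.
Qed.

End RealPart.

Lemma tr_sub_scalar_sqr (F : fieldType) n (A B : 'M[F]_n) (c : F) :
  \tr ((A - c%:M) *m (A - c%:M) *m B) =
  \tr (A *m A *m B) - c * (2 * \tr (A *m B)) + c * c * \tr B.
Proof.
rewrite !mulmxBl !mulmxBr !mulmxBl !mul_scalar_mx !mul_mx_scalar.
rewrite -!scalemxAl !linearB /= !linearZ /= mul_scalar_mx !linearZ /=; ring.
Qed.

Section Expectation.
Variables (R : realType) (n : nat).
Local Notation C := R[i].
Local Notation Re := (@complex.Re R).
Implicit Types A B rho : 'M[C]_n.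

Lemma psd_Re_diag_ge0 rho i : psdmx rho -> 0 <= Re (rho i i).
Proof. by move=> p; rewrite -ler0c -psd_diag_real// psd_diag_ge0. Qed.

(** Positivity on two basis vectors gives a quadratic polynomial in a real parameter [t],
    nonnegative everywhere; for [a > 0] it is evaluated at its minimum [t = m / a]. *)
Lemma psd_minor rho i j : psdmx rho -> nsq (rho i j) <= Re (rho i i) * Re (rho j j).
Proof.
move=> p; have := p.2.
have a0 := psd_Re_diag_ge0 i p; have b0 := psd_Re_diag_ge0 j p.
set a := Re (rho i i) in a0 *; set b := Re (rho j j) in b0 *.
set m := nsq (rho i j) => pos.
have m0 : 0 <= m by exact: nsq_ge0.
have quad (t : R) : 0 <= t ^+ 2 * a - 2 * t * m + m * b.
  (* The coefficient [rho i j] makes each of the two cross terms equal to the real number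
     [- t * m]. *)
  have := pos (t%:C%C *: delta_mx 0 i - rho i j *: delta_mx 0 j).
  rewrite form_delta2.
  rewrite [X in _ <= X -> _](_ : _ = (t ^+ 2 * a - 2 * t * m + m * b)%:C%C) ?ler0c//.
  rewrite (hermE i j p.1) (psd_diag_real i p) (psd_diag_real j p) -/a -/b.
  rewrite conj_real /m; case: (rho i j) => u v.
  by apply/eqP; rewrite eq_complex /nsq /=; apply/andP; split; apply/eqP; ring.
case: (eqVneq a 0) => [az|anz].
  (* With [a = 0] the polynomial is affine in [t], and its value here is [- 2 * m], which forces
     [m = 0]. *)
  have := quad (b / 2 + 1); rewrite az; nra.
have ap : 0 < a by rewrite lt_def anz a0.
have := quad (m / a).
have -> : (m / a) ^+ 2 * a - 2 * (m / a) * m + m * b = m * (a * b - m) / a.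
  by field.
rewrite pmulr_lge0 ?invr_gt0//.
case: (eqVneq m 0) => [-> _|mnz]; first by rewrite mulr_ge0.
by rewrite pmulr_rge0 ?subr_ge0// lt_def mnz.
Qed.

Lemma tr_herm_real A B : A ^t* = A -> B ^t* = B ->
  \tr (A *m B) = (Re (\tr (A *m B)))%:C%C.
Proof.
move=> hA hB; symmetry; apply: RRe_real; apply/CrealP.
rewrite -[LHS]/((\tr (A *m B))^*) -[in LHS](mxtrace_tr (A *m B)).
rewrite /mxtrace rmorph_sum /=; rewrite -[RHS]/(\tr (A *m B)) mxtrace_mulC -{2}hA -{2}hB.
rewrite -adjmxM /mxtrace.
by apply: eq_bigr => i _; rewrite adjmxE mxE.
Qed.

Lemma tr_sqr_ge0 A rho : A ^t* = A -> psdmx rho -> 0 <= Re (\tr (A *m A *m rho)).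
Proof.
move=> hA p; have := psd_trace_ge0 (psd_conjugate A p).
by rewrite hA mxtrace_mulC mulmxA lecE => /andP[].
Qed.

Lemma variance_expand A rho (c : R) : A ^t* = A -> density rho ->
  Re (\tr ((A - (c%:C%C)%:M) *m (A - (c%:C%C)%:M) *m rho)) =
  Re (\tr (A *m A *m rho)) - 2 * c * Re (\tr (A *m rho)) + c ^+ 2.
Proof.
move=> hA [p t1]; rewrite tr_sub_scalar_sqr t1 mulr1.
by rewrite ReD ReB !ReZ -(real_complex_nat R 2) ReZ /=; ring.
Qed.

(** Nonnegativity of the variance of [A] in the state [rho]. *)
Lemma sqr_mean_le A rho : A ^t* = A -> density rho ->
  Re (\tr (A *m rho)) ^+ 2 <= Re (\tr (A *m A *m rho)).
Proof.
move=> hA dr; set c := Re (\tr (A *m rho)).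
have h : (A - (c%:C%C)%:M) ^t* = A - (c%:C%C)%:M.
  by rewrite adjmxB hA tr_scalar_mx map_scalar_mx /= conj_real.
have := tr_sqr_ge0 h dr.1; rewrite variance_expand// -/c; nra.
Qed.

End Expectation.

Section Weights.
Variables (R : realType) (d : nat) (q : 'I_d -> R).
Hypothesis q0 : forall i, 0 < q i.
Local Notation C := R[i].
Local Notation Re := (@complex.Re R).

Definition bures_weight i j : R := 2 / (q i + q j).
Local Notation w := bures_weight.

(** With [D = diag q], this inverts [X |-> (D X + X D) / 2]: it is the symmetric logarithmic
    derivative at [D]. *)
Definition bures_map (X : 'M[C]_d) : 'M[C]_d := \matrix_(i, j) ((w i j)%:C%C * X i j).
Local Notation L := bures_map.

Definition bures_sqr (X : 'M[C]_d) : R := \sum_i \sum_j w i j * nsq (X i j).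

(** The real part of [tr (D^-1 X)] for [D = diag q]; at the average state it is the [b] of the
    variance bound. *)
Definition diag_ratio (X : 'M[C]_d) : R := \sum_i Re (X i i) / q i.

Lemma bures_weightE i j : w i j = 2 / (q i + q j). Proof. by []. Qed.

Lemma weight_sym i j : w i j = w j i.
Proof. by rewrite /w addrC. Qed.

Lemma weight_gt0 i j : 0 < w i j.
Proof. by rewrite divr_gt0 ?addr_gt0. Qed.

(** The weight is the reciprocal of the arithmetic mean of [q i] and [q j]. This is the comparison
    with the geometric mean; [weight_le_mean] is the one with the harmonic mean. *)
Lemma weight_sqr_le i j : w i j ^+ 2 <= (q i)^-1 * (q j)^-1.
Proof.
have qi := q0 i; have qj := q0 j.
rewrite /w -invfM expr_div_n ler_pdivrMr ?exprn_gt0 ?addr_gt0//.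
rewrite mulrC ler_pdivlMr ?mulr_gt0//.
by have := sqr_ge0 (q i - q j); lra.
Qed.

Lemma weight_le_mean i j : w i j <= ((q i)^-1 + (q j)^-1) / 2.
Proof.
have qi := q0 i; have qj := q0 j.
rewrite /w ler_pdivrMr ?addr_gt0//.
have -> : ((q i)^-1 + (q j)^-1) / 2 * (q i + q j) = (q i + q j) ^+ 2 / (2 * (q i * q j)).
  by field; rewrite !gt_eqF.
by rewrite ler_pdivlMr ?mulr_gt0//; have := sqr_ge0 (q i - q j); lra.
Qed.

Lemma weight_half_sum i j : (q i + q j) / 2 * w i j = 1.
Proof. by rewrite /w; field; rewrite gt_eqF ?addr_gt0. Qed.

Lemma bures_map_herm X : X ^t* = X -> (L X) ^t* = L X.
Proof.
move=> hX; apply/matrixP => i j; rewrite adjmxE !mxE rmorphM /= conj_real weight_sym.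
by rewrite -hermE.
Qed.

Lemma bures_mapD X Y : L (X + Y) = L X + L Y.
Proof. by apply/matrixP => i j; rewrite !mxE mulrDr. Qed.

Lemma bures_mapZ (a : C) X : L (a *: X) = a *: L X.
Proof. by apply/matrixP => i j; rewrite !mxE mulrCA. Qed.

Lemma bures_mapB X Y : L (X - Y) = L X - L Y.
Proof. by rewrite bures_mapD -scaleN1r bures_mapZ scaleN1r. Qed.

Lemma bures_map_sum (I : Type) (r : seq I) (P : pred I) (F : I -> 'M[C]_d) :
  L (\sum_(i <- r | P i) F i) = \sum_(i <- r | P i) L (F i).
Proof.
apply: (big_morph L bures_mapD); apply/matrixP => i j; by rewrite !mxE mulr0.
Qed.

Lemma tr_bures_map X Y : \tr (L X *m Y) = \sum_i \sum_j (w i j)%:C%C * (X i j * Y j i).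
Proof.
by rewrite /mxtrace; apply: eq_bigr => i _; rewrite mxE; apply: eq_bigr => j _;
  rewrite mxE mulrA.
Qed.

Lemma tr_bures_mapC X Y : \tr (L X *m Y) = \tr (L Y *m X).
Proof.
rewrite !tr_bures_map exchange_big; apply: eq_bigr => i _; apply: eq_bigr => j _.
by rewrite weight_sym [X _ _ * _]mulrC.
Qed.

Lemma tr_bures_sqr X : X ^t* = X -> \tr (L X *m X) = (bures_sqr X)%:C%C.
Proof.
move=> hX; rewrite tr_bures_map /bures_sqr -sum_real_complex; apply: eq_bigr => i _.
rewrite -sum_real_complex; apply: eq_bigr => j _.
by rewrite (hermE i j hX) mul_conjC_nsq -rmorphM.
Qed.

Lemma bures_sqr_ge0 X : 0 <= bures_sqr X.
Proof.
by apply: sumr_ge0 => i _; apply: sumr_ge0 => j _; rewrite mulr_ge0 ?nsq_ge0 ?ltW ?weight_gt0.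
Qed.

Lemma diag_ratio_ge0 rho : psdmx rho -> 0 <= diag_ratio rho.
Proof.
by move=> p; apply: sumr_ge0 => i _; rewrite divr_ge0 ?psd_Re_diag_ge0 ?ltW.
Qed.

(* As an operator inequality, [rho <= diag_ratio rho * diag q]. *)
Lemma psd_form_le_diag rho (x : 'rV[C]_d) : psdmx rho ->
  Re ((x *m rho *m x ^t*) 0 0) <= diag_ratio rho * \sum_i q i * nsq (x 0 i).
Proof.
move=> p; pose r i := Re (rho i i); pose y i := nsq (x 0 i).
have r0 i : 0 <= r i by exact: psd_Re_diag_ge0.
have y0 i : 0 <= y i by exact: nsq_ge0.
have -> : (x *m rho *m x ^t*) 0 0 = \sum_i \sum_j x 0 i * rho i j * (x 0 j)^*.
  rewrite mxE exchange_big; apply: eq_bigr => j _.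
  by rewrite mxE adjmxE mulr_suml.
rewrite Re_sum; under eq_bigr do rewrite Re_sum.
(* The product is symmetrised so that the two halves of each summand multiply to
   [y i * r i * r j * y j], which the 2 x 2 minor shows to dominate the squared modulus of the
   matching summand on the left. *)
have -> : diag_ratio rho * (\sum_i q i * nsq (x 0 i)) =
  \sum_i \sum_j ((q i * y i) * (r j / q j) + (q j * y j) * (r i / q i)) / 2.
  rewrite [RHS](eq_bigr (fun i => (q i * y i) / 2 * diag_ratio rho +
      (\sum_j q j * y j) / 2 * (r i / q i))); last first.
    move=> i _; rewrite -mulr_suml big_split /= -mulr_sumr -mulr_suml -/(diag_ratio rho).
    by rewrite /diag_ratio; ring.
  rewrite big_split /= -!mulr_suml -!mulr_sumr -/(diag_ratio rho).
  by field.
apply: ler_sum => i _; apply: ler_sum => j _.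
have qi := q0 i; have qj := q0 j.
apply: amgm2.
- by rewrite !mulr_ge0 ?invr_ge0// ltW.
- by rewrite !mulr_ge0 ?invr_ge0// ltW.
apply: (le_trans (Re_sqr_le_nsq _)); rewrite !nsqM nsqJ -/(y i) -/(y j).
have -> : q i * y i * (r j / q j) * (q j * y j * (r i / q i)) = y i * (r i * r j) * y j.
  by field; rewrite !gt_eqF.
by rewrite ler_wpM2r// ler_wpM2l// psd_minor.
Qed.

(** By cyclicity the trace sums the form of [rho] over the rows of [L X], and [psd_form_le_diag]
    bounds each row with the weights [q i]. Since [L X] is Hermitian, [q i] may be averaged with the
    row weight [q k], and this average cancels one of the two factors [w k i]. *)
Lemma tr_bures_map_sqr_le rho X : psdmx rho -> X ^t* = X ->
  Re (\tr (L X *m L X *m rho)) <= diag_ratio rho * bures_sqr X.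
Proof.
move=> p hX; have hL := bures_map_herm hX.
rewrite -mulmxA mxtrace_mulC -{2}hL /mxtrace Re_sum.
have -> : bures_sqr X = \sum_k \sum_i q i * nsq (L X k i).
  have E k i : nsq (L X k i) = w k i ^+ 2 * nsq (X k i).
    by rewrite mxE nsqM nsq_real.
  have S : \sum_k \sum_i q i * nsq (L X k i) = \sum_k \sum_i q k * nsq (L X k i).
    rewrite exchange_big; apply: eq_bigr => i _; apply: eq_bigr => k _.
    by rewrite -[in LHS]hL adjmxE nsqJ.
  have {}S : \sum_k \sum_i q i * nsq (L X k i) =
             \sum_k \sum_i (q k + q i) / 2 * nsq (L X k i).
    rewrite [LHS](_ : _ = (\sum_k \sum_i q k * nsq (L X k i) +
                           \sum_k \sum_i q i * nsq (L X k i)) / 2).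
      rewrite -big_split /= mulr_suml; apply: eq_bigr => k _.
      rewrite -big_split /= mulr_suml; apply: eq_bigr => i _.
      by rewrite -mulrDl mulrAC.
    by rewrite -S; field.
  rewrite S; apply: eq_bigr => k _; apply: eq_bigr => i _.
  by rewrite E expr2 -[_ * _ * nsq _]mulrA [RHS]mulrA weight_half_sum mul1r.
rewrite mulr_sumr; apply: ler_sum => k _.
rewrite (_ : (L X *m rho *m (L X) ^t*) k k =
             (row k (L X) *m rho *m (row k (L X)) ^t*) 0 0).
  apply: (le_trans (psd_form_le_diag _ p)).
  by rewrite ler_wpM2l ?diag_ratio_ge0//; apply: ler_sum => i _; rewrite mxE.
rewrite -row_mul !mxE; apply: eq_bigr => i _.
by rewrite !mxE.
Qed.

(** Entries are bounded by 2 x 2 minors and weights by the mean of reciprocals; the double sum then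
    factors, because the diagonal of [rho] sums to 1. *)
Lemma bures_sqr_density_le rho : density rho -> bures_sqr rho <= diag_ratio rho.
Proof.
move=> [p t1]; pose r i := Re (rho i i).
have r0 i : 0 <= r i by exact: psd_Re_diag_ge0.
have r1 : \sum_i r i = 1 by rewrite -Re_sum -/(\tr rho) t1.
have -> : diag_ratio rho = \sum_i \sum_j ((q i)^-1 + (q j)^-1) / 2 * (r i * r j).
  rewrite [RHS](eq_bigr (fun i => r i / q i / 2 + r i / 2 * diag_ratio rho)).
    rewrite big_split /= -!mulr_suml r1 -[\sum_i _ / _]/(diag_ratio rho).
    by field.
  move=> i _; rewrite [LHS](eq_bigr (fun j => r i / q i / 2 * r j +
      r i / 2 * (r j / q j))).
    by rewrite big_split /= -!mulr_sumr r1 mulr1.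
  by move=> j _; ring.
apply: ler_sum => i _; apply: ler_sum => j _.
by apply: ler_pM; rewrite ?nsq_ge0 ?psd_minor ?weight_le_mean// ltW ?weight_gt0.
Qed.

Lemma weight_sqr_sum_le rho1 rho2 : psdmx rho1 -> psdmx rho2 ->
  \sum_i \sum_j w i j ^+ 2 * (Re (rho1 i i) * Re (rho2 j j)) <=
  diag_ratio rho1 * diag_ratio rho2.
Proof.
move=> p1 p2; rewrite /diag_ratio mulr_suml; apply: ler_sum => i _.
rewrite mulr_sumr; apply: ler_sum => j _.
have -> : Re (rho1 i i) / q i * (Re (rho2 j j) / q j) =
   (q i)^-1 * (q j)^-1 * (Re (rho1 i i) * Re (rho2 j j)) by ring.
by rewrite ler_wpM2r ?weight_sqr_le// mulr_ge0 ?psd_Re_diag_ge0.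
Qed.

End Weights.

(** * Local observables on product states *)

Section MatrixAlgebra.
Variable F : fieldType.

Lemma mulmx_shift n (X Y : 'M[F]_n) (x y : F) :
  (X + x%:M) *m (Y + y%:M) = X *m Y + y *: X + x *: Y + (x * y)%:M.
Proof.
by rewrite mulmxDl !mulmxDr mul_mx_scalar !mul_scalar_mx scale_scalar_mx !addrA.
Qed.

Lemma tr_delta_mul n (A : 'M[F]_n) i j : \tr (delta_mx i j *m A) = A j i.
Proof.
rewrite mxtrace_mulC /mxtrace (bigD1 j) //= big1 ?addr0 => [|k kj].
  rewrite mxE (bigD1 i) //= big1 ?addr0; first by rewrite mxE !eqxx mulr1.
  by move=> k ki; rewrite mxE (negbTE ki) mulr0.
by rewrite mxE big1 // => l _; rewrite mxE (negbTE kj) andbF mulr0.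
Qed.

Lemma delta_mulmx n (i j k l : 'I_n) :
  delta_mx i j *m delta_mx k l = (j == k)%:R *: delta_mx i l :> 'M[F]_n.
Proof.
case: eqVneq => [->|h]; first by rewrite mul_delta_mx scale1r.
by rewrite mul_delta_mx_0 // scale0r.
Qed.

Lemma scaleD_mxE m n (a : F) (X Y : 'M[F]_(m, n)) i j :
  (a *: X + Y) i j = a * X i j + Y i j.
Proof. by rewrite !mxE. Qed.

End MatrixAlgebra.

Section Local.
Variables (R : realType) (T d : nat).
Local Notation C := R[i].
Local Notation N := (tens_dim T d).
Implicit Types (A B : 'M[C]_d) (s t u v : 'I_T).

Definition loc s A : 'M[C]_N := tens_state (fun u => if u == s then A else 1%:M).

Lemma locE s A i j : loc s A i j =
  A ((enum_val i : {ffun 'I_T -> 'I_d}) s) ((enum_val j : {ffun 'I_T -> 'I_d}) s) *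
  \prod_(u < T | u != s) ((enum_val i : {ffun 'I_T -> 'I_d}) u ==
                          (enum_val j : {ffun 'I_T -> 'I_d}) u)%:R.
Proof.
rewrite tens_stateE (bigD1 s) //= eqxx; congr (_ * _).
by apply: eq_bigr => u /negbTE ->; rewrite mxE.
Qed.

Lemma loc_linear s : linear (loc s).
Proof.
by move=> a A B; apply/matrixP => i j; rewrite scaleD_mxE !locE scaleD_mxE mulrDl mulrA.
Qed.

HB.instance Definition _ s := GRing.isLinear.Build C 'M[C]_d 'M[C]_N *:%R (loc s) (loc_linear s).

Lemma loc1 s : loc s 1%:M = 1%:M.
Proof. by rewrite -tens1; apply: eq_tens => u; case: eqP. Qed.

Lemma loc_scalar s (c : C) : loc s c%:M = c%:M.
Proof. by rewrite -scalemx1 linearZ /= loc1 scalemx1. Qed.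

Lemma loc_adj s A : (loc s A) ^t* = loc s (A ^t*).
Proof. by rewrite tens_adj; apply: eq_tens => u; case: eqP => // _; rewrite adjmx1. Qed.

Variable rho : 'I_T -> 'M[C]_d.
Hypothesis rho1 : forall t, \tr (rho t) = 1.

Definition expect (M : 'M[C]_N) : C := \tr (M *m tens_state rho).

Lemma expect_linear : linear_for *%R expect.
Proof.
by move=> a M M'; rewrite /expect mulmxDl linearD -scalemxAl linearZ.
Qed.

HB.instance Definition _ := GRing.isLinear.Build C 'M[C]_N C *%R expect expect_linear.

Lemma expect_tens F : expect (tens_state F) = \prod_t \tr (F t *m rho t).
Proof. by rewrite /expect tensM tens_tr. Qed.

Lemma expect_tens0 F s : \tr (F s *m rho s) = 0 -> expect (tens_state F) = 0.
Proof. by move=> h; rewrite expect_tens (bigD1 s) //= h mul0r. Qed.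

Lemma expect_loc_sqr s A B : expect (loc s A *m loc s B) = \tr (A *m B *m rho s).
Proof.
rewrite tensM expect_tens (bigD1 s) //= eqxx big1 ?mulr1 // => u /negbTE ->.
by rewrite !mul1mx.
Qed.

Lemma expect_loc2 s t A B : s != t ->
  expect (loc s A *m loc t B) = \tr (A *m rho s) * \tr (B *m rho t).
Proof.
move=> st; rewrite tensM expect_tens (bigD1 s) //= (bigD1 t) /=; last by rewrite eq_sym.
rewrite !eqxx.
rewrite (negbTE st) (eq_sym t s) (negbTE st) mulmx1 mul1mx big1 ?mulr1 //.
by move=> u /andP[/negbTE -> /negbTE ->]; rewrite !mul1mx.
Qed.

Lemma expect_loc4 s t A B A' B' : s != t ->
  expect ((loc s A *m loc t B) *m (loc s A' *m loc t B')) =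
  \tr (A *m A' *m rho s) * \tr (B *m B' *m rho t).
Proof.
move=> st; rewrite !tensM expect_tens (bigD1 s) //= (bigD1 t) /=; last by rewrite eq_sym.
rewrite !eqxx.
rewrite (negbTE st) (eq_sym t s) (negbTE st) !mulmx1 !mul1mx big1 ?mulr1 //.
by move=> u /andP[/negbTE -> /negbTE ->]; rewrite !mul1mx.
Qed.

(** The site [u] misses at least one of [s] and [t], and there a factor of mean zero stands
    alone. *)
Lemma expect_loc3_0 s t u A B D : s != t ->
  \tr (A *m rho s) = 0 -> \tr (B *m rho t) = 0 ->
  expect ((loc s A *m loc t B) *m loc u D) = 0.
Proof.
move=> st hA hB; rewrite !tensM; case: (eqVneq u s) => [->|us].
  by apply: (@expect_tens0 _ t); rewrite eqxx eq_sym (negbTE st) mul1mx mulmx1.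
by apply: (@expect_tens0 _ s); rewrite eqxx (negbTE st) eq_sym (negbTE us) !mulmx1.
Qed.

Lemma expect_loc3'_0 s t u A B D : s != t ->
  \tr (A *m rho s) = 0 -> \tr (B *m rho t) = 0 ->
  expect (loc u D *m (loc s A *m loc t B)) = 0.
Proof.
move=> st hA hB; rewrite !tensM; case: (eqVneq u s) => [->|us].
  by apply: (@expect_tens0 _ t); rewrite eqxx eq_sym (negbTE st) !mul1mx.
by apply: (@expect_tens0 _ s); rewrite eqxx (negbTE st) eq_sym (negbTE us) mul1mx mulmx1.
Qed.

(** Pairs that differ even as unordered pairs leave one of [s], [t] outside [u], [v]; the mean-zero
    factor on that site kills the expectation. *)
Lemma expect_loc4_0 s t u v A B A' B' : s != t -> u != v ->
  (u, v) != (s, t) -> (u, v) != (t, s) ->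
  \tr (A *m rho s) = 0 -> \tr (B *m rho t) = 0 ->
  expect ((loc s A *m loc t B) *m (loc u A' *m loc v B')) = 0.
Proof.
rewrite !xpair_eqE => st uv h1 h2 hA hB; rewrite !tensM.
have [/andP[su sv]|h] := boolP ((s != u) && (s != v)).
  apply: (@expect_tens0 _ s).
  by rewrite eqxx (negbTE st) (negbTE su) (negbTE sv) !mulmx1.
have /andP[tu tv] : (t != u) && (t != v).
  move: h; rewrite negb_and !negbK => /orP[] /eqP E; subst.
    by move: h1; rewrite eqxx /= eq_sym => ->; rewrite eq_sym st.
  by move: h2; rewrite eqxx andbT eq_sym => ->; rewrite eq_sym.
apply: (@expect_tens0 _ t).
by rewrite eqxx eq_sym (negbTE st) (negbTE tu) (negbTE tv) mul1mx !mulmx1.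
Qed.

Definition center s A : 'M[C]_d := A - (\tr (A *m rho s))%:M.

Lemma centerE s A : center s A = A - (\tr (A *m rho s))%:M. Proof. by []. Qed.

Lemma tr_center s A : \tr (center s A *m rho s) = 0.
Proof.
by rewrite mulmxBl linearB /= mul_scalar_mx linearZ /= rho1 mulr1 subrr.
Qed.

Lemma center_linear s : linear (center s).
Proof.
move=> a A B; rewrite /center mulmxDl -scalemxAl linearD linearZ /=.
by rewrite raddfD /= scalerBr scale_scalar_mx opprD addrACA.
Qed.

HB.instance Definition _ s :=
  GRing.isLinear.Build C 'M[C]_d 'M[C]_d *:%R (center s) (center_linear s).

Lemma loc_center s A : loc s A = loc s (center s A) + (\tr (A *m rho s))%:M.
Proof. by rewrite -(loc_scalar s) -linearD /= subrK. Qed.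

Lemma tr_center2 s A B :
  \tr (center s A *m center s B *m rho s) =
  \tr (A *m B *m rho s) - \tr (A *m rho s) * \tr (B *m rho s).
Proof.
rewrite -[center s A *m _ *m _]mulmxA {1}/center mulmxBl linearB /= mul_scalar_mx linearZ /=.
rewrite tr_center mulr0 subr0 /center mulmxBl mulmxBr linearB /= mul_scalar_mx -scalemxAr.
by rewrite linearZ /= mulmxA mulrC.
Qed.

End Local.

Section PairSums.
Variables (K : comNzRingType) (I : finType).

Lemma sum_pair_swap (V : nmodType) (F : I -> I -> V) :
  \sum_(p : I * I) F p.1 p.2 = \sum_(p : I * I) F p.2 p.1.
Proof.
rewrite (reindex_inj (h := fun p : I * I => (p.2, p.1))) //=.
by move=> [a b] [a' b'] [-> ->].
Qed.

Lemma sum2_mul_sub (P : finType) (w : P -> K) (A B A' B' : P -> P -> K) :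
  \sum_p \sum_r w p * (w r * ((A p r - B p r) * (A' p r - B' p r))) =
  \sum_p \sum_r w p * (w r * (A p r * A' p r)) -
  \sum_p \sum_r w p * (w r * (A p r * B' p r)) -
  \sum_p \sum_r w p * (w r * (B p r * A' p r)) +
  \sum_p \sum_r w p * (w r * (B p r * B' p r)).
Proof.
rewrite -!sumrB -big_split /=; apply: eq_bigr => p _.
by rewrite -!sumrB -big_split /=; apply: eq_bigr => r _; ring.
Qed.

End PairSums.

(** * Hoeffding decomposition of the collision observable *)

Section Variance.
Local Opaque loc center expect bures_weight bures_map tens_state.
Variables (R : realType) (T d : nat) (q : 'I_d -> R).
Hypothesis q0 : forall i, 0 < q i.
Local Notation C := R[i].
Local Notation Re := (@complex.Re R).
Local Notation N := (tens_dim T d).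
Local Notation w := (bures_weight q).
Local Notation L := (bures_map q).
Local Notation wC p := ((w p.1 p.2)%:C%C : C).
Local Notation e p := (delta_mx p.1 p.2 : 'M[C]_d).
Local Notation e' p := (delta_mx p.2 p.1 : 'M[C]_d).
Implicit Types (s t u v : 'I_T) (p r : 'I_d * 'I_d).

(* [\sum_p w_p e_p (x) e_p^*] on the sites [s] and [t]: its mean on
   [rho_s (x) rho_t] is [\tr (L rho_t *m rho_s)]. *)
Definition pair_obs s t : 'M[C]_N := \sum_p wC p *: (loc s (e p) *m loc t (e' p)).

Definition collision_obs : 'M[C]_N := \sum_s \sum_(t | t != s) pair_obs s t.

Lemma pair_obs_adj s t : (pair_obs s t) ^t* = pair_obs t s.
Proof.
rewrite adjmx_sum; apply: eq_bigr => p _.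
by rewrite adjmxZ adjmxM !loc_adj !adjmx_delta conj_real.
Qed.

(** Taking adjoints exchanges the two sites, which only permutes the ordered pairs. *)
Lemma collision_obs_herm : collision_obs ^t* = collision_obs.
Proof.
transitivity (\sum_s \sum_(t | t != s) pair_obs t s).
  rewrite adjmx_sum; apply: eq_bigr => s _; rewrite adjmx_sum.
  by apply: eq_bigr => t _; rewrite pair_obs_adj.
rewrite (exchange_big_dep xpredT) //=; apply: eq_bigr => s _.
by apply: eq_bigl => t; rewrite eq_sym.
Qed.

Lemma bures_map_delta (X : 'M[C]_d) : L X = \sum_p (wC p * X p.1 p.2) *: e p.
Proof.
rewrite [LHS]matrix_sum_delta pair_big /=.
by apply: eq_bigr => p _; rewrite mxE.
Qed.

(** Expansion in the transposed units, which are those on the second site of a pair. *)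
Lemma bures_map_delta' (X : 'M[C]_d) : L X = \sum_p (wC p * X p.2 p.1) *: e' p.
Proof.
rewrite bures_map_delta (sum_pair_swap (fun i j => ((w i j)%:C%C * X i j) *: delta_mx i j)).
by apply: eq_bigr => p _; rewrite weight_sym.
Qed.

Lemma tr_bures_map_pair (X Y : 'M[C]_d) :
  \tr (L X *m Y) = \sum_p wC p * (X p.1 p.2 * Y p.2 p.1).
Proof. by rewrite tr_bures_map pair_big. Qed.

Lemma tr_bures_map_sqr (X Y : 'M[C]_d) :
  \tr (L X *m L X *m Y) =
  \sum_p \sum_r wC p * (wC r * (X p.1 p.2 * X r.1 r.2 * \tr (e p *m e r *m Y))).
Proof.
rewrite {1}bures_map_delta mulmx_suml mulmx_suml linear_sum /=; apply: eq_bigr => p _.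
rewrite bures_map_delta mulmx_sumr mulmx_suml linear_sum /=; apply: eq_bigr => r _.
by rewrite -scalemxAl -scalemxAr scalerA -scalemxAl linearZ /= mulrACA !mulrA.
Qed.

Lemma tr_bures_map_sqr' (X Y : 'M[C]_d) :
  \tr (L X *m L X *m Y) =
  \sum_p \sum_r wC p * (wC r * (X p.2 p.1 * X r.2 r.1 * \tr (e' p *m e' r *m Y))).
Proof.
rewrite {1}bures_map_delta' mulmx_suml mulmx_suml linear_sum /=; apply: eq_bigr => p _.
rewrite bures_map_delta' mulmx_sumr mulmx_suml linear_sum /=; apply: eq_bigr => r _.
by rewrite -scalemxAl -scalemxAr scalerA -scalemxAl linearZ /= mulrACA !mulrA.
Qed.

Variable rho : 'I_T -> 'M[C]_d.
Hypothesis rhoD : forall t, density (rho t).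

Let rho1 t : \tr (rho t) = 1. Proof. exact: density_trace1. Qed.

Local Notation ctr := (center rho).
Local Notation ex := (expect rho).

(** The second-order part: both factors are centred, so the mean vanishes in either site alone. *)
Definition pair_fluct s t : 'M[C]_N :=
  \sum_p wC p *: (loc s (ctr s (e p)) *m loc t (ctr t (e' p))).

(* Hoeffding decomposition. *)
Lemma pair_obs_decomp s t : pair_obs s t =
  pair_fluct s t + loc s (ctr s (L (rho t))) + loc t (ctr t (L (rho s))) +
  (\tr (L (rho t) *m rho s))%:M.
Proof.
have -> : loc s (ctr s (L (rho t))) =
    \sum_p wC p *: (rho t p.1 p.2 *: loc s (ctr s (e p))).
  rewrite bures_map_delta !linear_sum /=; apply: eq_bigr => p _.
  by rewrite 2!linearZZ scalerA.
have -> : loc t (ctr t (L (rho s))) =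
    \sum_p wC p *: (rho s p.2 p.1 *: loc t (ctr t (e' p))).
  rewrite bures_map_delta' !linear_sum /=; apply: eq_bigr => p _.
  by rewrite 2!linearZZ scalerA.
have -> : (\tr (L (rho t) *m rho s))%:M =
    \sum_p wC p *: (rho s p.2 p.1 * rho t p.1 p.2)%:M :> 'M[C]_N.
  rewrite tr_bures_map_pair raddf_sum /=; apply: eq_bigr => p _.
  by rewrite scale_scalar_mx [rho s _ _ * _]mulrC.
rewrite -!big_split /=; apply: eq_bigr => p _.
rewrite (loc_center rho s) (loc_center rho t) mulmx_shift !tr_delta_mul.
by rewrite !scalerDr.
Qed.

(** The observable left on site [s] when the other copy of every pair is averaged out. *)
Definition site_mean s : 'M[C]_d := \sum_(t | t != s) L (rho t).

Definition collision_mean : C := \sum_s \sum_(t | t != s) \tr (L (rho t) *m rho s).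

Definition fluct2 : 'M[C]_N := \sum_s \sum_(t | t != s) pair_fluct s t.

Definition fluct1 : 'M[C]_N := \sum_s loc s (ctr s (site_mean s)).

Lemma collision_obs_decomp :
  collision_obs - collision_mean%:M = fluct2 + 2 *: fluct1.
Proof.
have E1 : \sum_s \sum_(t | t != s) loc s (ctr s (L (rho t))) = fluct1.
  by apply: eq_bigr => s _; rewrite !linear_sum.
(* The second sites contribute the same first-order sum as the first ones, hence the factor 2. *)
have E2 : \sum_s \sum_(t | t != s) loc t (ctr t (L (rho s))) = fluct1.
  rewrite (exchange_big_dep xpredT) //=; apply: eq_bigr => t _.
  by rewrite !linear_sum; apply: eq_bigl => s; rewrite eq_sym.
have E3 : \sum_s \sum_(t | t != s) (\tr (L (rho t) *m rho s))%:M = collision_mean%:M :> 'M[C]_N.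
  by rewrite /collision_mean raddf_sum /=; apply: eq_bigr => s _; rewrite raddf_sum.
have -> : collision_obs = fluct2 + fluct1 + fluct1 + collision_mean%:M.
  rewrite -{1}E1 -E2 -E3 -!big_split /=; apply: eq_bigr => s _.
  by rewrite -!big_split /=; apply: eq_bigr => t _; rewrite pair_obs_decomp.
by rewrite addrK scaler_nat mulr2n addrA.
Qed.

Lemma loc_comm s t (A B : 'M[C]_d) : s != t -> loc s A *m loc t B = loc t B *m loc s A.
Proof.
move=> st; rewrite !tensM; apply: eq_tens => u.
case: (eqVneq u s) => [->|_]; first by rewrite (negbTE st) mulmx1 mul1mx.
by case: ifP => _; rewrite ?mulmx1 ?mul1mx.
Qed.

(** The weight is symmetric and operators on distinct sites commute. *)
Lemma pair_fluct_sym s t : s != t -> pair_fluct s t = pair_fluct t s.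
Proof.
move=> st; pose F i j : 'M[C]_N := (w i j)%:C%C *:
  (loc s (ctr s (delta_mx i j)) *m loc t (ctr t (delta_mx j i))).
apply: (etrans (sum_pair_swap F)); apply: eq_bigr => p _.
by rewrite /F (weight_sym q p.2 p.1); apply: congr1; apply: loc_comm.
Qed.

Lemma expect_fluct21 : ex (fluct2 *m fluct1) = 0.
Proof.
rewrite mulmx_sumr linear_sum big1 //= => u _.
rewrite mulmx_suml linear_sum big1 //= => s _.
rewrite mulmx_suml linear_sum big1 //= => t ts.
rewrite mulmx_suml linear_sum big1 //= => p _.
by rewrite -scalemxAl linearZ /= expect_loc3_0 ?mulr0 ?tr_center // eq_sym.
Qed.

Lemma expect_fluct12 : ex (fluct1 *m fluct2) = 0.
Proof.
rewrite mulmx_suml linear_sum big1 //= => u _.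
rewrite mulmx_sumr linear_sum big1 //= => s _.
rewrite mulmx_sumr linear_sum big1 //= => t ts.
rewrite mulmx_sumr linear_sum big1 //= => p _.
by rewrite -scalemxAr linearZ /= expect_loc3'_0 ?mulr0 ?tr_center // eq_sym.
Qed.

Lemma expect_fluct1_sqr :
  ex (fluct1 *m fluct1) = \sum_s \tr (ctr s (site_mean s) *m ctr s (site_mean s) *m rho s).
Proof.
rewrite mulmx_suml linear_sum /=; apply: eq_bigr => s _.
rewrite mulmx_sumr linear_sum /= (bigD1 s) //= big1 ?addr0 ?expect_loc_sqr // => t ts.
by rewrite expect_loc2 1?eq_sym // tr_center // mul0r.
Qed.

Lemma expect_pair_fluct0 s t u v : s != t -> u != v ->
  (u, v) != (s, t) -> (u, v) != (t, s) ->
  ex (pair_fluct s t *m pair_fluct u v) = 0.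
Proof.
move=> st uv h1 h2.
rewrite mulmx_suml linear_sum big1 //= => p _.
rewrite mulmx_sumr linear_sum big1 //= => r _.
by rewrite -scalemxAl -scalemxAr !linearZ /= expect_loc4_0 ?tr_center ?mulr0.
Qed.

(** Against a given pair only the pair itself and its reversal survive, and these two give the same
    operator. *)
Lemma expect_fluct2_sqr :
  ex (fluct2 *m fluct2) =
  \sum_s \sum_(t | t != s) (ex (pair_fluct s t *m pair_fluct s t)) *+ 2.
Proof.
have -> : fluct2 = \sum_(P : 'I_T * 'I_T | P.2 != P.1) pair_fluct P.1 P.2.
  by rewrite /fluct2 pair_big_dep.
rewrite [RHS]pair_big_dep mulmx_suml linear_sum /=; apply: eq_bigr => -[s t] /= ts.
have st : s != t by rewrite eq_sym.
rewrite mulmx_sumr linear_sum /= (bigD1 (s, t)) //= (bigD1 (t, s)) /=; last first.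
  by rewrite st xpair_eqE negb_and ts.
rewrite -(pair_fluct_sym st) big1 ?addr0 ?mulr2n // => -[u v] /= /andP[/andP[vu h1] h2].
by rewrite expect_pair_fluct0 // eq_sym.
Qed.

Lemma expect_pair_fluct_sqr s t : s != t ->
  ex (pair_fluct s t *m pair_fluct s t) =
  \sum_p wC p * (wC p * (rho s p.1 p.1 * rho t p.2 p.2)) -
  \tr (L (rho t) *m L (rho t) *m rho s) - \tr (L (rho s) *m L (rho s) *m rho t) +
  \tr (L (rho t) *m rho s) ^+ 2.
Proof.
move=> st.
have -> : ex (pair_fluct s t *m pair_fluct s t) =
  \sum_p \sum_r wC p * (wC r *
   ((\tr (e p *m e r *m rho s) - \tr (e p *m rho s) * \tr (e r *m rho s)) *
    (\tr (e' p *m e' r *m rho t) - \tr (e' p *m rho t) * \tr (e' r *m rho t)))).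
  rewrite mulmx_suml linear_sum /=; apply: eq_bigr => p _.
  rewrite mulmx_sumr linear_sum /=; apply: eq_bigr => r _.
  by rewrite -scalemxAl linearZ /= -scalemxAr linearZ /= expect_loc4 // !(tr_center2 rho1).
rewrite sum2_mul_sub; congr (_ - _ - _ + _).
(* Only [r = (p.2, p.1)] contributes: for any other [r] one of the two products of matrix units is
   zero. *)
- apply: eq_bigr => p _; rewrite (bigD1 (p.2, p.1)) //= big1 ?addr0.
    by rewrite /= (weight_sym q p.2 p.1) !mul_delta_mx !tr_delta_mul.
  move=> [k l] /=; rewrite xpair_eqE negb_and => h.
  rewrite !delta_mulmx -!scalemxAl !linearZ /=.
  by case/orP: h => /negbTE; rewrite eq_sym => ->; rewrite ?mul0r ?mulr0 ?mul0r ?mulr0.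
- rewrite tr_bures_map_sqr; apply: eq_bigr => p _; apply: eq_bigr => r _.
  by rewrite !tr_delta_mul [_ * \tr _]mulrC.
- rewrite tr_bures_map_sqr'; apply: eq_bigr => p _; apply: eq_bigr => r _.
  by rewrite !tr_delta_mul.
rewrite expr2 tr_bures_map_pair mulr_suml; apply: eq_bigr => p _.
rewrite mulr_sumr; apply: eq_bigr => r _.
by rewrite !tr_delta_mul; ring.
Qed.

End Variance.

(** Parallelogram identity, valid without commutation. *)
Lemma sqr_sub_add n (F : fieldType) (X Y : 'M[F]_n) :
  (X - Y) *m (X - Y) = 2 *: (X *m X) + 2 *: (Y *m Y) - (X + Y) *m (X + Y).
Proof.
rewrite !mulmxBr !mulmxDr !mulmxBl !mulmxDl !scaler_nat !mulr2n !opprD !opprK.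
by apply/matrixP => i j; rewrite !mxE; ring.
Qed.

Lemma tr_mul_comb n (F : fieldType) (A B W X : 'M[F]_n) (a b : F) :
  \tr ((a *: A + b *: B - W) *m X) = a * \tr (A *m X) + b * \tr (B *m X) - \tr (W *m X).
Proof. by rewrite mulmxBl mulmxDl -!scalemxAl linearB linearD !linearZ. Qed.

Lemma tr_sqr_sub_le (R : realType) n (X Y rho : 'M[R[i]]_n) :
  X ^t* = X -> Y ^t* = Y -> psdmx rho ->
  complex.Re (\tr ((X - Y) *m (X - Y) *m rho)) <=
  2 * complex.Re (\tr (X *m X *m rho)) + 2 * complex.Re (\tr (Y *m Y *m rho)).
Proof.
move=> hX hY pr; rewrite sqr_sub_add.
have hXY : (X + Y) ^t* = X + Y by rewrite adjmxD hX hY.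
have := tr_sqr_ge0 hXY pr; move: ((X + Y) *m (X + Y)) => W.
rewrite tr_mul_comb ReB ReD -!(real_complex_nat R 2) !ReZ; lra.
Qed.

Lemma sum_sqr_le_sqr_sum (R : realType) (I : finType) (b : I -> R) :
  (forall i, 0 <= b i) -> \sum_i b i ^+ 2 <= (\sum_i b i) ^+ 2.
Proof.
move=> b0; rewrite [leRHS]expr2 mulr_suml; apply: ler_sum => i _.
rewrite expr2 ler_wpM2l // (bigD1 i) //= lerDl; exact: sumr_ge0.
Qed.

Lemma double_sum_trans (R : realType) (a c e f g k : R) :
  a <= 2 * c + 2 * e -> c <= f -> e <= g -> g <= k -> a <= 2 * f + 2 * k.
Proof. lra. Qed.

(** Origin of the constants 10 and 8: [a] and [c] are the second moments of [fluct2] and [fluct1],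
    and [fluct1] occurs with coefficient 2. *)
Lemma combine_fluct_bounds (R : realType) (a c e f : R) :
  a <= 2 * e -> c <= 2 * f + 2 * e -> a + 2 * (2 * c) <= 10 * e + 8 * f.
Proof. lra. Qed.

(** * Mean and variance of the collision observable *)

Section VarianceBound.
Local Opaque loc center expect bures_weight bures_map tens_state.
Variables (R : realType) (T d : nat) (q : 'I_d -> R).
Hypothesis q0 : forall i, 0 < q i.
Hypothesis q1 : \sum_i q i = 1.
Local Notation C := R[i].
Local Notation Re := (@complex.Re R).
Local Notation N := (tens_dim T d).
Local Notation w := (bures_weight q).
Local Notation L := (bures_map q).
Local Notation b := (diag_ratio q).
Variable rho : 'I_T -> 'M[C]_d.
Hypothesis rhoD : forall t, density (rho t).
Hypothesis T0 : (0 < T)%N.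
Local Notation ex := (expect rho).
Local Notation ctr := (center rho).
Local Notation rbar := (rho_avg rho).

Definition diag_state : 'M[C]_d := diag_mx (\row_i (q i)%:C%C).
Local Notation D := (rbar - diag_state).

Let rbarD : density rbar. Proof. exact: density_rho_avg. Qed.

Lemma diag_state_herm : diag_state ^t* = diag_state.
Proof.
by rewrite adjmx_diag; congr diag_mx; apply/rowP => i; rewrite !mxE conj_real.
Qed.

Lemma diag_state_trace : \tr diag_state = 1.
Proof.
rewrite mxtrace_diag (eq_bigr (fun i => (q i)%:C%C)) => [|i _]; last by rewrite mxE.
by rewrite sum_real_complex q1.
Qed.

Lemma bures_map_diag : L diag_state = 1%:M.
Proof.
apply/matrixP => i j; rewrite !mxE; case: eqP => [->|_]; last by rewrite mulr0n mulr0.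
rewrite !mulr1n -real_complexM bures_weightE.
by have -> : 2 / (q j + q j) * q j = 1 by field; rewrite gt_eqF ?addr_gt0.
Qed.

Lemma sum_rho : \sum_t rho t = T%:R *: rbar.
Proof. by rewrite /rho_avg scalerA divff ?scale1r // pnatr_eq0 -lt0n. Qed.

Lemma sum_diag_ratio : \sum_t b (rho t) = T%:R * b rbar.
Proof.
rewrite /diag_ratio exchange_big mulr_sumr; apply: eq_bigr => i _.
rewrite -mulr_suml -Re_sum -summxE sum_rho mxE mulrA; congr (_ / _).
by rewrite -[T%:R * _ in RHS]ReZ real_complex_nat.
Qed.

Lemma sub_diag_state_herm (tau : 'M[C]_d) :
  tau ^t* = tau -> (tau - diag_state) ^t* = tau - diag_state.
Proof. by move=> ht; rewrite adjmxB diag_state_herm ht. Qed.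

(** [L] sends the reference state to the identity, so the cross terms reduce to traces. Hence
    subtracting 1 in the divergence leaves a nonnegative quadratic form in the difference. *)
Lemma bures_sqr_shift (tau : 'M[C]_d) : density tau ->
  bures_sqr q tau = 1 + bures_sqr q (tau - diag_state).
Proof.
move=> dt; have ht := density_herm dt.
apply: complexI; rewrite real_complexD -(tr_bures_sqr q ht).
rewrite -(tr_bures_sqr q (sub_diag_state_herm ht)).
rewrite bures_mapB bures_map_diag mulmxBr !mulmxBl !mul1mx !linearB /=.
rewrite (tr_bures_mapC q tau diag_state) bures_map_diag mul1mx diag_state_trace.
by rewrite (density_trace1 dt); ring.
Qed.

Let D_herm : D ^t* = D. Proof. by rewrite sub_diag_state_herm // density_herm. Qed.

(* The two negative terms of [expect_pair_fluct_sqr] absorb the squared mean. *)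
Lemma Re_pair_fluct_sqr_le s t : s != t ->
  Re (ex (pair_fluct q rho s t *m pair_fluct q rho s t)) <= b (rho s) * b (rho t).
Proof.
move=> st; rewrite expect_pair_fluct_sqr // ReD !ReB.
have ps := (rhoD s).1; have pt := (rhoD t).1.
have hs := density_herm (rhoD s); have ht := density_herm (rhoD t).
have hLs := bures_map_herm q hs; have hLt := bures_map_herm q ht.
rewrite (tr_herm_real hLt hs) -real_complexX [Re (_%:C)%C]/=.
have := sqr_mean_le hLt (rhoD s).
have := tr_sqr_ge0 hLs pt.
suff : Re (\sum_p (w p.1 p.2)%:C%C * ((w p.1 p.2)%:C%C * (rho s p.1 p.1 * rho t p.2 p.2))) <=
       b (rho s) * b (rho t) by move: (Re _) (Re _) (Re _) (_ * _) => a a' a'' a'''; clear; lra.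
apply: le_trans (weight_sqr_sum_le q0 ps pt).
rewrite Re_sum pair_big /=; apply: ler_sum => p _.
by rewrite !ReZ (psd_diag_real p.1 ps) ReZ /= expr2 !mulrA.
Qed.

Lemma Re_fluct2_sqr_le : Re (ex (fluct2 q rho *m fluct2 q rho)) <= 2 * (T%:R * b rbar) ^+ 2.
Proof.
rewrite expect_fluct2_sqr // -sum_diag_ratio expr2 mulr_suml mulr_sumr Re_sum.
apply: ler_sum => s _; rewrite Re_sum mulr_sumr mulr_sumr big_mkcond /=.
(* The terms with [t = s], absent on the left, are nonnegative on the right and complete the
   square. *)
apply: ler_sum => t _; case: ifP => [ts|_]; last first.
  by rewrite !mulr_ge0 ?diag_ratio_ge0 //; have [] := rhoD s; have [] := rhoD t.
have Re2 (z : C) : Re (z *+ 2) = 2 * Re z by rewrite mulr2n ReD; ring.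
rewrite Re2 ler_wpM2l //.
by apply: Re_pair_fluct_sqr_le; rewrite eq_sym.
Qed.

Lemma center_herm s A : A ^t* = A -> (ctr s A) ^t* = ctr s A.
Proof.
move=> hA; rewrite centerE adjmxB hA (tr_herm_real hA (density_herm (rhoD s))).
by rewrite tr_scalar_mx map_scalar_mx /= conj_real.
Qed.

Lemma center_sqr_le s A : A ^t* = A ->
  Re (\tr (ctr s A *m ctr s A *m rho s)) <= Re (\tr (A *m A *m rho s)).
Proof.
move=> hA; rewrite tr_center2; last by move=> t; exact: density_trace1.
rewrite (tr_herm_real hA (density_herm (rhoD s))) -real_complexM ReB [Re (_ * _)%:C%C]/=.
by rewrite lerBlDr lerDl -expr2 sqr_ge0.
Qed.

(** Over all copies the sum of [L (rho t)] is [T (1 + L D)]. Centring kills the identity, leaving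
    the deviation [D] and the missing copy. *)
Lemma site_meanE s :
  ctr s (site_mean q rho s) = ctr s (T%:R *: L D) - ctr s (L (rho s)).
Proof.
have -> : site_mean q rho s = T%:R *: L D + (T%:R)%:M - L (rho s).
  have -> : site_mean q rho s = \sum_t L (rho t) - L (rho s).
    by rewrite (bigD1 s) //= addrAC subrr add0r.
  rewrite -bures_map_sum sum_rho bures_mapZ bures_mapB bures_map_diag scalerBr.
  by rewrite scalemx1 subrK.
rewrite linearB linearD /=.
have -> : ctr s (T%:R)%:M = 0.
  by rewrite centerE mul_scalar_mx linearZ /= (density_trace1 (rhoD s)) mulr1 subrr.
by rewrite addr0.
Qed.

Lemma Re_site_mean_le s :
  Re (\tr (ctr s (site_mean q rho s) *m ctr s (site_mean q rho s) *m rho s)) <=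
  2 * (T%:R ^+ 2 * Re (\tr (L D *m L D *m rho s))) + 2 * b (rho s) ^+ 2.
Proof.
rewrite site_meanE.
have hD := bures_map_herm q D_herm.
have hr := bures_map_herm q (density_herm (rhoD s)).
have hTD : (T%:R *: L D) ^t* = T%:R *: L D by rewrite adjmxZ hD conjC_nat.
have cD := center_sqr_le s hTD; have cr := center_sqr_le s hr.
have h := tr_sqr_sub_le (center_herm s hTD) (center_herm s hr) (rhoD s).1.
have E : Re (\tr ((T%:R *: L D) *m (T%:R *: L D) *m rho s)) <=
         T%:R ^+ 2 * Re (\tr (L D *m L D *m rho s)).
  rewrite -scalemxAl -scalemxAr scalerA -scalemxAl linearZ /= -natrM -real_complex_nat.
  by rewrite ReZ natrM expr2.
have B : Re (\tr (L (rho s) *m L (rho s) *m rho s)) <= b (rho s) ^+ 2.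
  apply: (le_trans (tr_bures_map_sqr_le q0 (rhoD s).1 (density_herm (rhoD s)))).
  rewrite expr2 ler_wpM2l ?bures_sqr_density_le //.
  by apply: diag_ratio_ge0 => //; have [] := rhoD s.
exact: (@double_sum_trans R _ _ _ _ _ _ h (le_trans cD E) cr B).
Qed.

(** The first term of each site bound is linear in [rho s], so its sum involves only the average
    state and gains one factor [T]. *)
Lemma Re_fluct1_sqr_le :
  Re (ex (fluct1 q rho *m fluct1 q rho)) <=
  2 * (T%:R ^+ 3 * (b rbar * bures_sqr q D)) + 2 * (T%:R * b rbar) ^+ 2.
Proof.
rewrite expect_fluct1_sqr // Re_sum.
apply: (le_trans (ler_sum _ (fun s _ => Re_site_mean_le s))).
rewrite big_split /= -!mulr_sumr; apply: lerD; rewrite ler_wpM2l //; last first.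
  rewrite -sum_diag_ratio; apply: sum_sqr_le_sqr_sum => s.
  by apply: diag_ratio_ge0 => //; have [] := rhoD s.
rewrite -Re_sum -linear_sum /= -mulmx_sumr sum_rho -scalemxAr linearZ /=.
rewrite -real_complex_nat ReZ mulrA -exprSr ler_wpM2l ?exprn_ge0 //.
by apply: tr_bures_map_sqr_le => //; exact: rbarD.1.
Qed.

(** The diagonal pairs are added and removed again: the completed double sum depends on the average
    state alone. *)
Lemma collision_meanE : collision_mean q rho =
  (T%:R ^+ 2 * bures_sqr q rbar - \sum_s bures_sqr q (rho s))%:C%C.
Proof.
have -> : collision_mean q rho = \sum_s (\tr (L (\sum_t rho t) *m rho s) - \tr (L (rho s) *m rho s)).
  apply: eq_bigr => s _; rewrite bures_map_sum mulmx_suml linear_sum /=.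
  by rewrite [in RHS](bigD1 s) //= addrAC subrr add0r.
rewrite sumrB -linear_sum /= -mulmx_sumr sum_rho bures_mapZ -scalemxAl -scalemxAr scalerA.
rewrite linearZ /= tr_bures_sqr ?density_herm // real_complexB real_complexM real_complexX real_complex_nat -expr2.
congr (_ - _); rewrite -sum_real_complex; apply: eq_bigr => s _.
by rewrite tr_bures_sqr // density_herm.
Qed.

Lemma collision_mean_le :
  Re (collision_mean q rho) <= T%:R ^+ 2 * (1 + bures_sqr q D).
Proof.
rewrite collision_meanE -(bures_sqr_shift rbarD) /= lerBlDr lerDl.
by apply: sumr_ge0 => s _; apply: bures_sqr_ge0.
Qed.

Lemma collision_mean_ge :
  T%:R ^+ 2 * (1 + bures_sqr q D) - T%:R * b rbar <= Re (collision_mean q rho).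
Proof.
rewrite collision_meanE -(bures_sqr_shift rbarD) /= lerB // -sum_diag_ratio.
by apply: ler_sum => s _; apply: bures_sqr_density_le.
Qed.

Lemma collision_variance_le (m := Re (collision_mean q rho)) :
  Re (ex ((collision_obs T q - (m%:C%C)%:M) *m (collision_obs T q - (m%:C%C)%:M))) <=
  10 * (T%:R * b rbar) ^+ 2 + 8 * (T%:R ^+ 3 * (b rbar * bures_sqr q D)).
Proof.
have -> : m%:C%C = collision_mean q rho by rewrite /m collision_meanE.
rewrite collision_obs_decomp // mulmxDl !mulmxDr -!scalemxAl -!scalemxAr !linearD /=.
have Z2 (M : 'M[C]_N) : ex (2 *: M) = 2 * ex M by rewrite linearZ.
rewrite !Z2 expect_fluct12 // expect_fluct21 // mulr0 addr0 add0r.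
rewrite -!(real_complex_nat R 2) !ReZ.
exact: (@combine_fluct_bounds R _ _ _ _ Re_fluct2_sqr_le Re_fluct1_sqr_le).
Qed.

(* AM-GM on each [D i i / q i]; the parameter [lam] is later taken of order [T]. *)
Lemma diag_ratio_le (gamma lam : R) : 0 < gamma -> 0 < lam ->
  (forall i, gamma <= q i) ->
  b rbar <= d%:R + (lam * bures_sqr q D + d%:R / (lam * gamma)) / 2.
Proof.
move=> g0 l0 gq.
have -> : b rbar = d%:R + \sum_i Re (D i i) / q i.
  rewrite -[d in d%:R]card_ord -sumr_const -big_split /=; apply: eq_bigr => i _.
  rewrite !mxE eqxx mulr1n ReB /= mulrBl divff ?gt_eqF //; ring.
rewrite lerD2l mulr_sumr -[d in d%:R]card_ord -mulr_natl -sumr_const.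
rewrite mulr1 mulr_suml -big_split /= mulr_suml.
apply: ler_sum => i _; have qi := q0 i.
(* As [w i i = 1 / q i], the two terms multiply to exactly the square of [D i i / q i]. *)
apply: (@le_trans _ _ ((lam * (w i i * Re (D i i) ^+ 2) + (lam * q i)^-1) / 2)).
  apply: amgm2.
  - by apply: mulr_ge0; [exact: ltW | apply: mulr_ge0; [exact/ltW/weight_gt0 | exact: sqr_ge0]].
  - by rewrite invr_ge0 ltW // mulr_gt0.
  rewrite bures_weightE le_eqVlt; apply/orP; left; apply/eqP; field.
  by rewrite !gt_eqF ?addr_gt0.
rewrite ler_pM2r ?invr_gt0 //; apply: lerD.
  rewrite ler_pM2l // (bigD1 i) //=.
  apply: ler_wpDr; last by rewrite ler_wpM2l ?Re_sqr_le_nsq ?ltW ?weight_gt0.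
  by apply: sumr_ge0 => j _; rewrite mulr_ge0 ?nsq_ge0 ?ltW ?weight_gt0.
by rewrite div1r lef_pV2 ?posrE ?mulr_gt0 // ler_pM2l.
Qed.

End VarianceBound.

(** * The chi-square test for a diagonal state *)

Section Numerics.
Variable R : realType.
Implicit Types (T d b x theta gamma k m V : R).

(** The true gap [g] between mean and threshold is replaced by a simpler lower bound [G], against
    which the variance is measured. *)
Lemma chebyshev_gap (a g G V : R) :
  a * g ^+ 2 <= V -> 0 < G -> G <= g -> V <= G ^+ 2 / 100 -> a <= 1 / 100.
Proof.
move=> h G0 Gg hV; rewrite leNgt; apply/negP => ha.
have G2 : G ^+ 2 <= g ^+ 2 by rewrite ler_sqr ?nnegrE //; lra.
have G20 : 0 < G ^+ 2 by rewrite exprn_gt0.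
nra.
Qed.

Lemma le_99_100 (a : R) : 1 - a <= 1 / 100 -> 99 / 100 <= a.
Proof. lra. Qed.

(** [k] is the reciprocal of the constant in the sample bound. The last hypothesis is
    [diag_ratio_le] with [lam = T * k], the choice that makes both of its error terms of order
    [T * k * (theta + x)]. *)
Lemma variance_budget T d b x theta gamma k :
  0 < T -> 0 < theta -> 0 < gamma -> 0 < k -> k <= 1 -> 0 <= x -> 0 <= b ->
  d <= T * theta * k -> d / gamma <= T ^+ 2 * theta * k ^+ 2 ->
  b <= d + (T * k * x + d / (T * k * gamma)) / 2 ->
  b <= T * (2 * k * (theta + x)) /\
  10 * (T * b) ^+ 2 + 8 * (T ^+ 3 * (b * x)) <= T ^+ 4 * (56 * k * (theta + x) ^+ 2).
Proof.
move=> T0 th0 g0 k0 k1 x0 b0 hd1 hd2 hb.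
have hb' : b <= T * (2 * k * (theta + x)).
  have e : d / (T * k * gamma) <= T * theta * k.
    have -> : d / (T * k * gamma) = d / gamma / (T * k) by field; rewrite !gt_eqF.
    rewrite ler_pdivrMr ?mulr_gt0 //; apply: le_trans hd2 _.
    by rewrite le_eqVlt; apply/orP; left; apply/eqP; ring.
  have : 0 <= T * (k * x) by rewrite !mulr_ge0 ?(ltW T0) ?(ltW k0).
  have : 0 <= T * (theta * k) by rewrite !mulr_ge0 ?ltW.
  lra.
split=> //; set y := 2 * k * (theta + x) in hb'.
have s0 : 0 <= theta + x by rewrite addr_ge0 ?(ltW th0).
have y0 : 0 <= y by rewrite !mulr_ge0 ?(ltW k0).
have Ty0 : 0 <= T * y by rewrite mulr_ge0 ?(ltW T0).
have h1 : (T * b) ^+ 2 <= T ^+ 4 * y ^+ 2.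
  have -> : T ^+ 4 * y ^+ 2 = (T * (T * y)) ^+ 2 by ring.
  have Tb0 : 0 <= T * b by rewrite mulr_ge0 ?(ltW T0).
  have TTy0 : 0 <= T * (T * y) by rewrite mulr_ge0 ?(ltW T0).
  by rewrite ler_sqr ?nnegrE // ler_pM2l.
have h2 : T ^+ 3 * (b * x) <= T ^+ 4 * (y * x).
  have -> : T ^+ 4 * (y * x) = T ^+ 3 * (T * y * x) by ring.
  by rewrite ler_wpM2l ?exprn_ge0 ?(ltW T0) // ler_wpM2r.
(* Here [56 = 10 * 4 + 8 * 2], and [k ^+ 2] is weakened to [k] in the first term. *)
have h3 : 10 * y ^+ 2 + 8 * (y * x) <= 56 * k * (theta + x) ^+ 2.
  have e1 : y ^+ 2 <= 4 * k * (theta + x) ^+ 2.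
    have -> : y ^+ 2 = 4 * (k * k) * (theta + x) ^+ 2 by rewrite /y; ring.
    by rewrite ler_wpM2r ?sqr_ge0 // ler_pM2l //; rewrite ler_piMr // ltW.
  have e2 : y * x <= 2 * k * (theta + x) ^+ 2.
    have xs : x <= theta + x by rewrite lerDr ltW.
    by have := ler_wpM2l y0 xs; rewrite /y; lra.
  lra.
have T4 : 0 <= T ^+ 4 by rewrite exprn_ge0 ?ltW.
have := ler_wpM2l T4 h3; lra.
Qed.

(** The threshold uses [199 / 200], the midpoint of 0.99 and 1, so the margin is [theta / 200]. The
    missing diagonal pairs only lower the mean, which is favourable here. *)
Lemma null_gap T x theta k m V : 0 < T -> 0 < theta -> 0 <= k -> k <= 1 / 10 ^+ 10 ->
  0 <= x -> x <= 99 / 100 * theta ->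
  m <= T ^+ 2 * (1 + x) -> V <= T ^+ 4 * (56 * k * (theta + x) ^+ 2) ->
  let G := T ^+ 2 * (theta / 200) in
  [/\ 0 < G, G <= T ^+ 2 * (1 + 199 / 200 * theta) - m & V <= G ^+ 2 / 100].
Proof.
move=> T0 th0 k0 hk x0 hx hm hV G.
have T2 : 0 < T ^+ 2 by rewrite exprn_gt0.
have T4 : 0 < T ^+ 4 by rewrite exprn_gt0.
split; first by rewrite mulr_gt0 ?divr_gt0.
  have := ler_wpM2l (ltW T2) hx; rewrite /G; lra.
apply: (le_trans hV); rewrite /G.
have -> : (T ^+ 2 * (theta / 200)) ^+ 2 / 100 = T ^+ 4 * (theta ^+ 2 / (200 ^+ 2 * 100)) by field.
rewrite ler_wpM2l ?(ltW T4) //.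
have s : (theta + x) ^+ 2 <= 4 * theta ^+ 2 by nra.
have t2 : 0 < theta ^+ 2 by rewrite exprn_gt0.
have h1 : 56 * k * (theta + x) ^+ 2 <= 56 * k * (4 * theta ^+ 2).
  by rewrite ler_wpM2l // mulr_ge0.
have h2 := ler_wpM2r (ltW t2) hk.
lra.
Qed.

(** The margin must grow with [x], as the standard deviation does. Of [x / 200] the bias takes at
    most [x / 1000], leaving [x / 250]. *)
Lemma alternative_gap T b x theta k m V :
  0 < T -> 0 < theta -> 0 <= k -> k <= 1 / 10 ^+ 10 -> theta < x ->
  T ^+ 2 * (1 + x) - T * b <= m -> b <= T * (2 * k * (theta + x)) ->
  V <= T ^+ 4 * (56 * k * (theta + x) ^+ 2) ->
  let G := T ^+ 2 * (x / 250) in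
  [/\ 0 < G, G <= m - T ^+ 2 * (1 + 199 / 200 * theta) & V <= G ^+ 2 / 100].
Proof.
move=> T0 th0 k0 hk hx hm hb hV G.
have T2 : 0 < T ^+ 2 by rewrite exprn_gt0.
have T4 : 0 < T ^+ 4 by rewrite exprn_gt0.
have x0 : 0 < x by lra.
split; first by rewrite mulr_gt0 ?divr_gt0.
  have h1 := ler_wpM2l (ltW T0) hb.
  have h2 : 2 * k * (theta + x) <= x / 1000.
    have := ler_wpM2r (ltW x0) hk; have : k * theta <= k * x by rewrite ler_wpM2l ?(ltW hx).
    lra.
  have h3 := ler_wpM2l (ltW T2) h2.
  have h4 := ler_wpM2l (ltW T2) (ltW hx).
  rewrite /G; lra.
apply: (le_trans hV); rewrite /G.
have -> : (T ^+ 2 * (x / 250)) ^+ 2 / 100 = T ^+ 4 * (x ^+ 2 / (250 ^+ 2 * 100)) by field.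
rewrite ler_wpM2l ?(ltW T4) //.
have s : (theta + x) ^+ 2 <= 4 * x ^+ 2 by nra.
have t2 : 0 < x ^+ 2 by rewrite exprn_gt0.
have h1 : 56 * k * (theta + x) ^+ 2 <= 56 * k * (4 * x ^+ 2).
  by rewrite ler_wpM2l // mulr_ge0.
have h2 := ler_wpM2r (ltW t2) hk.
lra.
Qed.

End Numerics.

Section DiagonalTest.
Variables (R : realType) (T d : nat) (q : 'I_d -> R) (gamma theta : R).
Local Notation C := R[i].

Lemma diagonal_chi2_test :
  (forall i, 0 < q i) -> \sum_i q i = 1 ->
  0 < gamma -> (forall i, gamma <= q i) -> 0 < theta -> (0 < T)%N ->
  10 ^+ 10 * (d%:R / theta) <= T%:R ->
  (10 ^+ 10) ^+ 2 * (d%:R / (theta * gamma)) <= T%:R ^+ 2 ->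
  exists E : 'M[C]_(tens_dim T d), effect E /\
    forall rho : 'I_T -> 'M[C]_d, (forall t, density (rho t)) ->
      let x := bures_sqr q (rho_avg rho - diag_state q) in
      (x <= 99 / 100 * theta -> 99 / 100 <= accept_prob E (tens_state rho)) /\
      (theta < x -> accept_prob E (tens_state rho) <= 1 / 100).
Proof.
move=> q0 q1 g0 gq th0 T0 hT1 hT2.
pose k : R := 1 / 10 ^+ 10; pose t : R := T%:R; pose dd : R := d%:R.
have K0 : 0 < 10 ^+ 10 :> R by rewrite exprn_gt0.
have k0 : 0 < k by rewrite divr_gt0.
have k1 : k <= 1 by rewrite /k; lra.
have t0 : 0 < t by rewrite ltr0n.
have hd1 : dd <= t * theta * k.
  rewrite -/dd -/t in hT1; rewrite /k mulrA mulr1 ler_pdivlMr //.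
  by move: hT1; rewrite mulrA ler_pdivrMr // [dd * _]mulrC.
have hd2 : dd / gamma <= t ^+ 2 * theta * k ^+ 2.
  rewrite -/dd -/t in hT2; rewrite /k expr_div_n expr1n mulrA mulr1.
  rewrite ler_pdivlMr ?exprn_gt0 //.
  have e K : K ^+ 2 * (dd / (theta * gamma)) = dd / gamma * K ^+ 2 / theta.
    by rewrite invfM; ring.
  by move: hT2; rewrite e ler_pdivrMr.
have [E [eE hE]] := chebyshev_effect (t ^+ 2 * (1 + 199 / 200 * theta))
   (collision_obs_herm T q).
exists E; split=> // rho rD x.
have x0 : 0 <= x by exact: bures_sqr_ge0.
have b0 : 0 <= diag_ratio q (rho_avg rho).
  by apply: diag_ratio_ge0 => //; have [] := density_rho_avg T0 rD.
have tk0 : 0 < t * k by rewrite mulr_gt0.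
have hb := diag_ratio_le q0 rho g0 tk0 gq.
have [hb' hV] := variance_budget t0 th0 g0 k0 k1 x0 b0 hd1 hd2 hb.
have [a [-> ha]] := hE _ (tens_density rD).
have vle := collision_variance_le q0 rD T0.
have mle := collision_mean_le q0 q1 rD T0.
have mge := collision_mean_ge q0 q1 rD T0.
set m := complex.Re _ in vle mle mge.
have [h1 h2] := ha m _ (le_trans vle hV).
have C99 : (99 / 100 : C) = ((99 / 100 : R)%:C)%C.
  by rewrite real_complexM real_complex_nat -(real_complex_nat R 100) -rmorphV ?unitfE ?pnatr_eq0.
have C1 : (1 / 100 : C) = ((1 / 100 : R)%:C)%C.
  by rewrite real_complexM -(real_complex_nat R 100) -rmorphV ?unitfE ?pnatr_eq0.
rewrite C99 C1 !lecR; split=> hx.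
  have [G0 Gg GV] := null_gap t0 th0 (ltW k0) (lexx _) x0 hx mle (lexx _).
  have lt_m : m < t ^+ 2 * (1 + 199 / 200 * theta) by rewrite -subr_gt0; exact: lt_le_trans Gg.
  exact/le_99_100/(chebyshev_gap (h1 lt_m) G0 Gg GV).
have [G0 Gg GV] := alternative_gap t0 th0 (ltW k0) (lexx _) hx mge hb' (lexx _).
have lt_m : t ^+ 2 * (1 + 199 / 200 * theta) < m by rewrite -subr_gt0; exact: lt_le_trans Gg.
exact: chebyshev_gap (h2 lt_m) G0 Gg GV.
Qed.

End DiagonalTest.

(** * Trace norm *)

Section TraceNorm.
Variable R : realType.
Local Notation C := R[i].
Local Notation Re := (@complex.Re R).

(** Partial isometries instead of unitaries: the polar factor of a singular matrix then needs no
    completion on the kernel. *)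
Definition partial_isometry n (U : 'M[C]_n) : Prop := U *m U ^t* *m U = U.

Lemma partial_isometry_adj n (U : 'M[C]_n) :
  partial_isometry U -> partial_isometry (U ^t*).
Proof.
move=> hU; have := congr1 (fun M : 'M[C]_n => M ^t*) hU.
by rewrite /partial_isometry !adjmxM trmxCK mulmxA.
Qed.

Lemma partial_isometry_conj n (U P : 'M[C]_n) : P ^t* *m P = 1%:M ->
  partial_isometry U -> partial_isometry (P *m U *m P ^t*).
Proof.
move=> hP hU; rewrite /partial_isometry !adjmxM trmxCK !mulmxA.
rewrite -[P *m U *m P ^t* *m P]mulmxA hP mulmx1.
rewrite -[_ *m P ^t* *m P]mulmxA hP mulmx1.
by rewrite -[P *m U *m U ^t*]mulmxA -[P *m _ *m U]mulmxA hU.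
Qed.

Lemma mul_adj_diag n (U : 'M[C]_n) i : (U *m U ^t*) i i = (\sum_j nsq (U i j))%:C%C.
Proof.
rewrite mxE -sum_real_complex; apply: eq_bigr => j _.
by rewrite adjmxE mul_conjC_nsq.
Qed.

(** [G = U U^*] is a Hermitian projection, so its diagonal entry [g] is the squared norm of a row of
    [G], and [g >= g ^+ 2]. *)
Lemma partial_isometry_row n (U : 'M[C]_n) i :
  partial_isometry U -> \sum_j nsq (U i j) <= 1.
Proof.
move=> hU; set g := \sum_j _; pose G := U *m U ^t*.
have Gi : G i i = g%:C%C by exact: mul_adj_diag.
have GG : G *m G ^t* = G by rewrite /G adjmxM trmxCK mulmxA hU.
have : g = \sum_j nsq (G i j) by apply: complexI; rewrite -(mul_adj_diag G) GG.
rewrite (bigD1 i) //= Gi nsq_real => e.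
have : 0 <= \sum_(j | j != i) nsq (G i j) by apply: sumr_ge0 => j _; exact: nsq_ge0.
have g0 : 0 <= g by apply: sumr_ge0 => j _; exact: nsq_ge0.
nra.
Qed.

Lemma partial_isometry_col n (U : 'M[C]_n) j :
  partial_isometry U -> \sum_i nsq (U i j) <= 1.
Proof.
move=> /partial_isometry_adj/(@partial_isometry_row _ _ j).
by under eq_bigr do rewrite adjmxE nsqJ.
Qed.

(* [U] is the adjoint of the polar factor of [A]. *)
Lemma trnorm_partial_isometry n (A : 'M[C]_n) :
  exists2 U : 'M[C]_n, partial_isometry U & trnorm A = \tr (U *m A).
Proof.
have pS : psdmx (A ^t* *m A) by have := psd_gram (A ^t*); rewrite trmxCK.
set S := A ^t* *m A in pS *; pose P := spectralmx S; pose s := spectral_diag S.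
have s0 i : 0 <= s 0 i by exact: psd_spectral_ge0.
(* The convention [0^-1 = 0] makes this a pseudo-inverse: the kernel of [A] drops out, so [U] is a
   partial isometry. *)
pose c : 'rV[C]_n := \row_i (sqrtC (s 0 i))^-1.
have [M hM] : exists M : 'M[C]_n, M = P *m A ^t* by exists (P *m A ^t*).
have MM : M *m M ^t* = diag_mx s.
  by rewrite hM adjmxM trmxCK mulmxA -[P *m _ *m A]mulmxA (spectral_diagE pS.1).
have cs i : c 0 i * s 0 i = sqrtC (s 0 i).
  rewrite mxE -{2}[s 0 i]sqrtCK expr2 mulrA.
  have [->|h] := eqVneq (sqrtC (s 0 i)) 0; first by rewrite mulr0.
  by rewrite mulVf // mul1r.
have csc i : c 0 i * s 0 i * (c 0 i)^* * c 0 i = c 0 i.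
  rewrite cs geC0_conj; last by rewrite mxE invr_ge0 sqrtC_ge0.
  rewrite mxE; have [->|h] := eqVneq (sqrtC (s 0 i)) 0; first by rewrite invr0 mulr0.
  by rewrite divff // mul1r.
exists (P ^t* *m diag_mx c *m M).
  rewrite /partial_isometry !adjmxM trmxCK !mulmxA.
  rewrite -[_ *m P *m P ^t*]mulmxA spectralmx_mulmx_adj mulmx1.
  rewrite -[_ *m M *m M ^t*]mulmxA MM -!mulmxA; congr (_ *m _); rewrite !mulmxA.
  congr (_ *m _); rewrite adjmx_diag !mulmx_diag; congr diag_mx.
  by apply/rowP => i; rewrite -(csc i) !mxE.
rewrite -!mulmxA mxtrace_mulC -!mulmxA.
have -> : M *m (A *m P ^t*) = diag_mx s by rewrite -MM hM adjmxM trmxCK.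
rewrite mulmx_diag mxtrace_diag /trnorm; apply: eq_bigr => i _.
by rewrite [RHS]mxE cs.
Qed.

(** Weighted Cauchy-Schwarz: [X] carries the Bures weights and [U] their reciprocals. The weighted
    norm of [U] is at most 1, since its rows and columns have norm at most 1 and [q] sums to 1. *)
Lemma partial_isometry_tr_sqr_le n (q : 'I_n -> R) (U X : 'M[C]_n) :
  (forall i, 0 < q i) -> \sum_i q i = 1 -> partial_isometry U ->
  0 <= Re (\tr (U *m X)) -> Re (\tr (U *m X)) ^+ 2 <= bures_sqr q X.
Proof.
move=> q0 q1 hU; set t := Re _ => t0; set B := bures_sqr q X.
have B0 : 0 <= B by exact: bures_sqr_ge0.
have hq : \sum_i \sum_j (q i + q j) / 2 * nsq (U i j) <= 1.
  rewrite [leLHS](_ : _ = (\sum_i q i * \sum_j nsq (U i j) +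
                           \sum_j q j * \sum_i nsq (U i j)) / 2).
    have h1 : \sum_i q i * \sum_j nsq (U i j) <= 1.
      rewrite -q1; apply: ler_sum => i _.
      by rewrite ler_piMr ?(ltW (q0 i)) // partial_isometry_row.
    have h2 : \sum_j q j * \sum_i nsq (U i j) <= 1.
      rewrite -q1; apply: ler_sum => i _.
      by rewrite ler_piMr ?(ltW (q0 i)) // partial_isometry_col.
    lra.
  under [X in _ = (_ + X) / 2]eq_bigr do rewrite mulr_sumr.
  rewrite [X in _ = (_ + X) / 2]exchange_big -big_split /= mulr_suml.
  apply: eq_bigr => i _; rewrite mulr_sumr -big_split /= mulr_suml.
  by apply: eq_bigr => j _; ring.
have key (lam : R) : 0 < lam -> t <= (lam * B + lam^-1) / 2.
  move=> l0; apply: (@le_trans _ _ ((lam * B +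
      lam^-1 * \sum_i \sum_j (q i + q j) / 2 * nsq (U i j)) / 2)); last first.
    rewrite ler_pM2r ?invr_gt0 // lerD2l.
    by rewrite -[leRHS]mulr1 ler_wpM2l // invr_ge0 ltW.
  rewrite /B /bures_sqr exchange_big !mulr_sumr -big_split /= mulr_suml.
  rewrite /t /mxtrace Re_sum; apply: ler_sum => i _.
  rewrite !mulr_sumr -big_split /= mulr_suml mxE Re_sum; apply: ler_sum => j _.
  have w0 := weight_gt0 q0 j i; have qi := q0 i; have qj := q0 j.
  apply: amgm2.
  - by apply: mulr_ge0; [exact: ltW | apply: mulr_ge0; [exact: ltW | exact: nsq_ge0]].
  - by rewrite !mulr_ge0 ?nsq_ge0 ?invr_ge0 ?(ltW l0) // ltW // addr_gt0.
  apply: (le_trans (Re_sqr_le_nsq _)); rewrite nsqM.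
  rewrite le_eqVlt; apply/orP; left; apply/eqP.
  rewrite bures_weightE; field.
  by rewrite !gt_eqF ?addr_gt0.
have [->|tn] := eqVneq t 0; first by rewrite expr0n.
have tp : 0 < t by rewrite lt_def tn.
(* Taking [lam = 1 / t] gives [t <= (B / t + t) / 2], that is [t ^+ 2 <= B], without a square root
   of [B]. *)
have := key t^-1; rewrite invr_gt0 invrK => /(_ tp).
have -> : (t^-1 * B + t) / 2 = (B + t ^+ 2) / (2 * t) by field.
rewrite ler_pdivlMr ?mulr_gt0 //; lra.
Qed.

Lemma conj_unitary_tr n (U A P : 'M[C]_n) : P ^t* *m P = 1%:M ->
  \tr (U *m A) = \tr ((P *m U *m P ^t*) *m (P *m A *m P ^t*)).
Proof.
move=> hP; rewrite [RHS]mxtrace_mulC !mulmxA -[_ *m P ^t* *m P]mulmxA hP mulmx1.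
by rewrite mxtrace_mulC !mulmxA hP mul1mx mxtrace_mulC.
Qed.

(** In the eigenbasis of [rho] the trace averages the diagonal of a conjugated partial isometry
    against the eigenvalues, and each diagonal entry is bounded by its row norm. *)
Lemma partial_isometry_density n (U rho : 'M[C]_n) :
  partial_isometry U -> density rho -> `|Re (\tr (U *m rho))| <= 1.
Proof.
move=> hU dr; have hP := spectralmx_adj_mulmx rho.
rewrite (conj_unitary_tr _ _ hP) (spectral_diagE (density_herm dr)).
have := partial_isometry_conj hP hU; set U' := _ *m U *m _ => hU'.
have t1 : \sum_i Re (spectral_diag rho 0 i) = 1.
  rewrite -Re_sum -mxtrace_diag -(spectral_diagE (density_herm dr)).
  by rewrite mxtrace_mulC mulmxA hP mul1mx (density_trace1 dr).
rewrite mul_mx_diag /mxtrace Re_sum -t1; apply: (le_trans (ler_norm_sum _ _ _)).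
apply: ler_sum => i _; rewrite mxE mulrC.
rewrite (herm_spectral_real i (density_herm dr)) ReZ /=.
have s0 : 0 <= Re (spectral_diag rho 0 i).
  by rewrite -ler0c -(herm_spectral_real i (density_herm dr)) psd_spectral_ge0 //; have [] := dr.
rewrite normrM ger0_norm // ler_piMr //.
rewrite -(@ler_sqr _ _ 1) ?nnegrE // expr1n real_normK ?num_real //.
apply: (le_trans (Re_sqr_le_nsq _)); apply: le_trans (partial_isometry_row i hU').
by rewrite (bigD1 i) //= lerDl; apply: sumr_ge0 => j _; exact: nsq_ge0.
Qed.

Lemma trnorm_ge0 n (A : 'M[C]_n) : 0 <= trnorm A.
Proof.
apply: sumr_ge0 => i _; rewrite sqrtC_ge0 psd_spectral_ge0 //.
by have := psd_gram (A ^t*); rewrite trmxCK.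
Qed.

Lemma trnorm_real n (A : 'M[C]_n) : trnorm A = (Re (trnorm A))%:C%C.
Proof. by rewrite RRe_real // ger0_real // trnorm_ge0. Qed.

Lemma trnorm_sub_density_le n (rho sigma : 'M[C]_n) :
  density rho -> density sigma -> Re (trnorm (rho - sigma)) <= 2.
Proof.
move=> dr ds; have [U hU ->] := trnorm_partial_isometry (rho - sigma).
rewrite mulmxBr linearB ReB /=.
have := partial_isometry_density hU dr; have := partial_isometry_density hU ds.
rewrite !ler_norml => /andP[h1 _] /andP[_ h2]; lra.
Qed.

Lemma trnorm_sqr_le n (q : 'I_n -> R) (A P : 'M[C]_n) :
  (forall i, 0 < q i) -> \sum_i q i = 1 -> P ^t* *m P = 1%:M ->
  Re (trnorm A) ^+ 2 <= bures_sqr q (P *m A *m P ^t*).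
Proof.
move=> q0 q1 hP; have := trnorm_ge0 A; rewrite lecE => /andP[_] /=.
have [U hU ->] := trnorm_partial_isometry A; rewrite (conj_unitary_tr _ _ hP).
by apply: partial_isometry_tr_sqr_le => //; exact: partial_isometry_conj.
Qed.

End TraceNorm.

(** * Arbitrary reference states *)

Section Chi2Test.
Variable R : realType.
Local Notation C := R[i].
Local Notation Re := (@complex.Re R).

Section Spectrum.
Variables (d : nat) (sigma : 'M[C]_d).
Hypothesis sigmaD : density sigma.
Local Notation P := (spectralmx sigma).

Definition spectrum (i : 'I_d) : R := Re (spectral_diag sigma 0 i).
Local Notation q := spectrum.

Lemma spectrumE i : spectral_diag sigma 0 i = (q i)%:C%C.
Proof. exact/herm_spectral_real/density_herm. Qed.

Lemma spectrum_sum : \sum_i q i = 1.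
Proof.
rewrite -Re_sum -mxtrace_diag -(spectral_diagE (density_herm sigmaD)).
by rewrite mxtrace_mulC mulmxA spectralmx_adj_mulmx mul1mx (density_trace1 sigmaD).
Qed.

Lemma diag_state_spectrum : diag_state q = P *m sigma *m P ^t*.
Proof.
rewrite (spectral_diagE (density_herm sigmaD)); congr diag_mx.
by apply/rowP => i; rewrite mxE spectrumE.
Qed.

(** Positivity of the spectrum keeps every denominator nonzero, and [bures_sqr_shift] absorbs the
    subtracted 1. *)
Lemma chi2E (rho : 'M[C]_d) : (forall i, 0 < q i) -> density rho ->
  chi2 rho sigma = (bures_sqr q (P *m (rho - sigma) *m P ^t*))%:C%C.
Proof.
move=> q0 dr; rewrite mulmxBr mulmxBl -diag_state_spectrum.
have dr' := density_unitary (spectralmx_adj_mulmx sigma) dr.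
have -> : bures_sqr q (P *m rho *m P ^t* - diag_state q) =
          bures_sqr q (P *m rho *m P ^t*) - 1.
  by rewrite (bures_sqr_shift q0 spectrum_sum dr'); ring.
rewrite real_complexB /chi2 /=; congr (_ - _).
rewrite -sum_real_complex; apply: eq_bigr => i _.
rewrite -sum_real_complex; apply: eq_bigr => j _.
rewrite real_complexM bures_weightE sqr_norm_nsq !spectrumE; congr (_ * _).
by rewrite real_complexM real_complex_nat -real_complexD fmorphV.
Qed.

Lemma rho_avg_conj T (rho : 'I_T -> 'M[C]_d) (M : 'M[C]_d) :
  rho_avg (fun t => M *m rho t *m M ^t*) = M *m rho_avg rho *m M ^t*.
Proof.
rewrite /rho_avg -mulmx_suml -mulmx_sumr.
by rewrite -scalemxAr -scalemxAl.
Qed.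

Lemma chi2_test T (gamma theta : R) :
  0 < gamma -> (forall i, gamma <= q i) -> 0 < theta -> (0 < T)%N ->
  10 ^+ 10 * (d%:R / theta) <= T%:R ->
  (10 ^+ 10) ^+ 2 * (d%:R / (theta * gamma)) <= T%:R ^+ 2 ->
  exists E : 'M[C]_(tens_dim T d), effect E /\
    forall rho : 'I_T -> 'M[C]_d, (forall t, density (rho t)) ->
      (chi2 (rho_avg rho) sigma <= ((99/100 * theta)%:C)%C ->
         99 / 100 <= accept_prob E (tens_state rho)) /\
      ((theta%:C)%C < chi2 (rho_avg rho) sigma ->
         accept_prob E (tens_state rho) <= 1 / 100).
Proof.
move=> g0 gq th0 T0 hT1 hT2.
have q0 i : 0 < q i by exact: lt_le_trans (gq i).
have [E [eE hE]] := diagonal_chi2_test q0 spectrum_sum g0 gq th0 T0 hT1 hT2.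
(* The change to the eigenbasis of [sigma] is a channel with a single Kraus operator, along which
   the diagonal test is pulled back. *)
have hK : \sum_(k : unit) P ^t* *m P = 1%:M.
  by rewrite big_const card_unit /= addr0 spectralmx_adj_mulmx.
have [E' [eE' hE']] := effect_pullback hK eE.
exists E'; split=> // rho rD.
rewrite hE' (chi2E q0 (density_rho_avg T0 rD)) lecR ltcR.
pose rho' t := P *m rho t *m P ^t*.
have -> : tens_state (fun t => \sum_(k : unit) P *m rho t *m P ^t*) = tens_state rho'.
  by apply: eq_tens => t; rewrite big_const card_unit /= addr0.
have rD' t : density (rho' t) by exact/density_unitary/rD/spectralmx_adj_mulmx.
have := hE rho' rD'.
by rewrite /= /rho' rho_avg_conj mulmxBr mulmxBl diag_state_spectrum.
Qed.

End Spectrum.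

(** The rows of the unitary [spectralmx A] are left eigenvectors. This carries a lower bound on all
    eigenvalues over to the spectrum. *)
Lemma spectral_diag_eigenvalue d (A : 'M[C]_d) i :
  A ^t* = A -> eigenvalue A (spectral_diag A 0 i).
Proof.
move=> hA; apply/eigenvalueP; exists (row i (spectralmx A)).
  rewrite -row_mul; have -> : spectralmx A *m A = diag_mx (spectral_diag A) *m spectralmx A.
    by rewrite -(spectral_diagE hA) -[RHS]mulmxA spectralmx_adj_mulmx mulmx1.
  by apply/rowP => j; rewrite mul_diag_mx !mxE.
apply/eqP => h; have := congr1 (fun M : 'rV_d => (M *m (spectralmx A) ^t*) 0 i) h.
rewrite -row_mul spectralmx_mulmx_adj mul0mx !mxE eqxx => /eqP.
by rewrite oner_eq0.
Qed.

Lemma density_dim_gt0 d (sigma : 'M[C]_d) : density sigma -> (0 < d)%N.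
Proof.
case: d sigma => // sigma [_ /eqP].
by rewrite /mxtrace big_ord0 eq_sym oner_eq0.
Qed.

(** * The depolarizing channel *)

Section Depolarize.
Variables (d : nat).
Hypothesis d0 : (0 < d)%N.

(* Composing with this channel removes the dependence on the minimum eigenvalue
   in part (ii): the output spectrum is bounded below by [1 / (2 d)]. *)
Definition depolarize (rho : 'M[C]_d) : 'M[C]_d :=
  ((1 / 2 : R)%:C)%C *: rho + (((1 / (2 * d%:R)) : R)%:C)%C%:M.

(** Conjugating by all matrix units and summing sends [rho] to [\tr rho] times the identity; on
    inputs of trace 1 this is the constant part of [depolarize]. *)
Definition depolarize_kraus (k : option ('I_d * 'I_d)) : 'M[C]_d :=
  if k is Some p then ((Num.sqrt (1 / (2 * d%:R)) : R)%:C)%C *: delta_mx p.1 p.2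
  else ((Num.sqrt (1 / 2) : R)%:C)%C%:M.

Let d0R : 0 < d%:R :> R. Proof. by rewrite ltr0n. Qed.

Lemma big_option (V : nmodType) (I : finType) (F : option I -> V) :
  \sum_k F k = F None + \sum_i F (Some i).
Proof.
rewrite (bigD1 None) //=; congr (_ + _).
rewrite (reindex_omap Some id) => [|[i|] //] /=.
by apply: eq_bigl => i; rewrite eqxx.
Qed.

Lemma sqrt_sqr_complex (a : R) : 0 <= a ->
  ((Num.sqrt a)%:C * (Num.sqrt a)%:C = a%:C)%C.
Proof. by move=> a0; rewrite -real_complexM -expr2 sqr_sqrtr. Qed.

Lemma delta_sandwich (rho : 'M[C]_d) i j :
  (delta_mx i j : 'M[C]_d) *m rho *m (delta_mx j i : 'M[C]_d) = rho j j *: delta_mx i i.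
Proof.
apply/matrixP => k l; rewrite !mxE (bigD1 j) //= big1 ?addr0 => [|m mj]; last first.
  by rewrite !mxE (negbTE mj) mulr0.
rewrite !mxE (bigD1 j) //= big1 ?addr0 => [|m mj]; last first.
  by rewrite !mxE (negbTE mj) andbF mul0r.
by rewrite !mxE eqxx andbT /= -mulnb natrM mulrCA mulrA.
Qed.

Lemma sum_delta_diag : \sum_(i < d) delta_mx i i = 1%:M :> 'M[C]_d.
Proof.
apply/matrixP => k l; rewrite summxE (bigD1 k) //= big1 ?addr0 => [|m mk].
  by rewrite !mxE eqxx eq_sym.
by rewrite mxE eq_sym (negbTE mk).
Qed.

Lemma depolarize_kraus_unital :
  \sum_k (depolarize_kraus k) ^t* *m depolarize_kraus k = 1%:M.
Proof.
rewrite big_option /=.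
have -> : (((Num.sqrt (1 / 2) : R)%:C)%C%:M : 'M[C]_d) ^t* *m ((Num.sqrt (1 / 2) : R)%:C)%C%:M
        = ((1 / 2 : R)%:C)%C%:M.
  by rewrite tr_scalar_mx map_scalar_mx /= conj_real -scalar_mxM sqrt_sqr_complex // divr_ge0.
have -> : \sum_(p : 'I_d * 'I_d)
    (((Num.sqrt (1 / (2 * d%:R)) : R)%:C)%C *: (delta_mx p.1 p.2 : 'M[C]_d)) ^t* *m
    (((Num.sqrt (1 / (2 * d%:R)) : R)%:C)%C *: delta_mx p.1 p.2) = ((1 / 2 : R)%:C)%C%:M.
  transitivity (\sum_(i < d) \sum_(j < d) ((1 / (2 * d%:R) : R)%:C)%C *: (delta_mx j j : 'M[C]_d)).
    rewrite pair_big; apply: eq_bigr => p _ /=.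
    rewrite adjmxZ conj_real adjmx_delta -scalemxAl -scalemxAr mul_delta_mx scalerA.
    by rewrite sqrt_sqr_complex // divr_ge0 // mulr_ge0 // ltW.
  rewrite sumr_const card_ord -scaler_sumr sum_delta_diag scalemx1 -scaler_nat scale_scalar_mx.
  rewrite -(real_complex_nat R d) -real_complexM; congr ((_%:C)%C%:M).
  by field; rewrite gt_eqF.
rewrite -raddfD /= -real_complexD; have -> : 1 / 2 + 1 / 2 = 1 :> R by field.
by [].
Qed.

Lemma depolarizeE (rho : 'M[C]_d) : \tr rho = 1 ->
  \sum_k depolarize_kraus k *m rho *m (depolarize_kraus k) ^t* = depolarize rho.
Proof.
move=> t1; rewrite big_option /= /depolarize; congr (_ + _).
  rewrite tr_scalar_mx map_scalar_mx /= conj_real mul_scalar_mx mul_mx_scalar scalerA.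
  by rewrite sqrt_sqr_complex // divr_ge0.
transitivity (\sum_(i < d) \sum_(j < d)
   ((1 / (2 * d%:R) : R)%:C)%C *: (rho j j *: (delta_mx i i : 'M[C]_d))).
  rewrite pair_big; apply: eq_bigr => p _ /=.
  rewrite adjmxZ conj_real adjmx_delta -!scalemxAl -scalemxAr delta_sandwich [LHS]scalerA.
  by rewrite sqrt_sqr_complex // divr_ge0 // mulr_ge0 // ltW.
under eq_bigr do rewrite -scaler_sumr -scaler_suml -/(\tr rho) t1 scale1r.
by rewrite -scaler_sumr sum_delta_diag scalemx1.
Qed.

Lemma depolarize_density (rho : 'M[C]_d) : density rho -> density (depolarize rho).
Proof.
move=> [pr t1]; split.
  apply: psdD; first by apply: psd_scale => //; rewrite ler0c divr_ge0.
  rewrite -scalemx1; apply: psd_scale; last exact: psd1.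
  by rewrite ler0c divr_ge0 // mulr_ge0 // ltW.
rewrite linearD linearZ /= t1 mulr1 mxtrace_scalar -[_%:C%C *+ d]mulr_natr -(real_complex_nat R d).
rewrite -real_complexM -real_complexD.
by have -> : 1 / 2 + 1 / (2 * d%:R) * d%:R = 1 :> R by field; rewrite gt_eqF.
Qed.

Lemma rho_avg_depolarize T (rho : 'I_T -> 'M[C]_d) : (0 < T)%N ->
  rho_avg (fun t => depolarize (rho t)) = depolarize (rho_avg rho).
Proof.
move=> T0; rewrite /rho_avg big_split /= -scaler_sumr scalerDr scalerA mulrC -scalerA.
apply: congr1; rewrite sumr_const card_ord -[_%:M *+ T]scaler_nat scalerA mulVf ?scale1r //.
by rewrite pnatr_eq0 -lt0n.
Qed.

Lemma depolarizeB (rho sigma : 'M[C]_d) :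
  depolarize rho - depolarize sigma = ((1 / 2 : R)%:C)%C *: (rho - sigma).
Proof. by rewrite /depolarize opprD addrACA subrr addr0 scalerBr. Qed.

(** In the eigenbasis of the output, the identity part supplies the bound and half of [sigma] keeps
    a nonnegative diagonal. *)
Lemma depolarize_spectrum_ge (sigma : 'M[C]_d) i : density sigma ->
  1 / (2 * d%:R) <= spectrum (depolarize sigma) i.
Proof.
move=> ds; have ds' := depolarize_density ds.
set s := depolarize sigma in ds' *; rewrite /spectrum.
have -> : spectral_diag s 0 i = (spectralmx s *m s *m (spectralmx s) ^t*) i i.
  by rewrite (spectral_diagE (density_herm ds')) mxE eqxx mulr1n.
rewrite {2}/s /depolarize mulmxDr mulmxDl mul_mx_scalar -scalemxAl spectralmx_mulmx_adj.
rewrite -scalemxAr -scalemxAl scalemx1 mxE ReD [X in _ <= Re X + _]mxE ReZ.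
rewrite [X in _ <= _ + Re X]mxE eqxx mulr1n /= lerDr.
rewrite mulr_ge0 ?divr_ge0 //; apply: psd_Re_diag_ge0.
by have [] := density_unitary (spectralmx_adj_mulmx s) ds.
Qed.

End Depolarize.

(** * Testing in trace distance *)

Lemma bures_sqrZ d (q : 'I_d -> R) (a : R) (X : 'M[C]_d) :
  bures_sqr q ((a%:C)%C *: X) = a ^+ 2 * bures_sqr q X.
Proof.
rewrite /bures_sqr mulr_sumr; apply: eq_bigr => i _; rewrite mulr_sumr.
by apply: eq_bigr => j _; rewrite mxE nsqM nsq_real mulrCA.
Qed.

Lemma effect1 n : effect (1%:M : 'M[C]_n).
Proof.
split; first exact: psd1.
by rewrite subrr -(scale0r 1%:M); apply: psd_scale; [exact: lexx | exact: psd1].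
Qed.

Lemma Dtr_le1 d (rho sigma : 'M[C]_d) : density rho -> density sigma ->
  Dtr rho sigma <= 1.
Proof.
move=> dr ds; rewrite /Dtr trnorm_real.
rewrite ler_pdivrMl // mulr1 -(real_complex_nat R 2) lecR.
exact: trnorm_sub_density_le.
Qed.

(** The channel halves the difference of the states, which matches the factor 1/2 in [Dtr]: the
    divergence after the channel is at least [Dtr ^+ 2], so the chi-square test is run with
    [theta = eps ^+ 2]. *)
Lemma trace_distance_test d (sigma : 'M[C]_d) (eps : R) (T : nat) :
  density sigma -> 0 < eps -> (0 < T)%N ->
  2 * 10 ^+ 10 * (d%:R / eps ^+ 2) <= T%:R ->
  exists E : 'M[C]_(tens_dim T d), effect E /\
    forall rho : 'I_T -> 'M[C]_d, (forall t, density (rho t)) ->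
      (rho_avg rho = sigma -> 99 / 100 <= accept_prob E (tens_state rho)) /\
      ((eps%:C)%C < Dtr (rho_avg rho) sigma ->
         accept_prob E (tens_state rho) <= 1 / 100).
Proof.
move=> ds e0 T0 hT; have d0 := density_dim_gt0 ds.
have d0R : 0 < d%:R :> R by rewrite ltr0n.
(* For [eps > 1] the far case is empty and accepting always is correct; otherwise [eps <= 1] enters
   the second sample requirement. *)
have [e1|e1] := ltP 1 eps.
  exists 1%:M; split=> [|rho rD]; first exact: effect1.
  split=> [_|h].
    rewrite /accept_prob mul1mx (density_trace1 (tens_density rD)).
    by rewrite ler_pdivrMr // mul1r ler_nat.
  have := lt_le_trans h (Dtr_le1 (density_rho_avg T0 rD) ds).
  by rewrite -[1 in X in X -> _]/((1 : R)%:C)%C ltcR ltNge (ltW e1).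
have ds' := depolarize_density d0 ds; set s := depolarize sigma in ds'.
pose gamma : R := 1 / (2 * d%:R).
have g0 : 0 < gamma by rewrite divr_gt0 // mulr_gt0.
have gq i : gamma <= spectrum s i by exact: depolarize_spectrum_ge.
have th0 : 0 < eps ^+ 2 by rewrite exprn_gt0.
have K0 : 0 < 10 ^+ 10 :> R by rewrite exprn_gt0.
have de0 : 0 < d%:R / eps ^+ 2 by rewrite divr_gt0.
have hT1 : 10 ^+ 10 * (d%:R / eps ^+ 2) <= T%:R.
  apply: le_trans hT; rewrite -mulrA ler_peMl ?ler1n //.
  by rewrite ltW // mulr_gt0.
have hT2 : (10 ^+ 10) ^+ 2 * (d%:R / (eps ^+ 2 * gamma)) <= T%:R ^+ 2.
  have h : (2 * 10 ^+ 10 * (d%:R / eps ^+ 2)) ^+ 2 <= T%:R ^+ 2.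
    by rewrite ler_sqr ?nnegrE ?ler0n // ltW // mulr_gt0 // mulr_gt0.
  apply: le_trans h.
  (* With [gamma = 1 / (2 d)] the second requirement has the order of the square of the first; the
     leading 2 of the sample bound, squared, covers [2 * eps ^+ 2]. *)
  have -> : d%:R / (eps ^+ 2 * gamma) = 2 * eps ^+ 2 * (d%:R / eps ^+ 2) ^+ 2.
    by rewrite /gamma; field; rewrite !gt_eqF.
  set D := (d%:R / eps ^+ 2) ^+ 2; set K := 10 ^+ 10.
  have -> : (2 * K * (d%:R / eps ^+ 2)) ^+ 2 = K ^+ 2 * (4 * D) by rewrite /D; ring.
  rewrite ler_wpM2l ?sqr_ge0 // ler_wpM2r ?sqr_ge0 //.
  have : eps ^+ 2 <= 1 by rewrite expr_le1 // ltW.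
  lra.
have [E [eE hE]] := chi2_test ds' g0 gq th0 T0 hT1 hT2.
have [E' [eE' hE']] := effect_pullback (depolarize_kraus_unital d0) eE.
exists E'; split=> // rho rD.
have -> : accept_prob E' (tens_state rho) =
          accept_prob E (tens_state (fun t => depolarize (rho t))).
  by rewrite hE'; congr accept_prob; apply: eq_tens => t; rewrite depolarizeE // density_trace1.
have [h1 h2] := hE _ (fun t => depolarize_density d0 (rD t)).
have q0 i : 0 < spectrum s i by exact: lt_le_trans (gq i).
have aD := density_rho_avg T0 rD.
move: h1 h2; rewrite rho_avg_depolarize // (chi2E ds' q0 (depolarize_density d0 aD)).
rewrite depolarizeB -scalemxAr -scalemxAl bures_sqrZ lecR ltcR => h1 h2; split=> h.
  apply: h1; rewrite h subrr mulmx0 mul0mx.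
  have -> : bures_sqr (spectrum s) 0 = 0.
    rewrite /bures_sqr big1 // => i _; rewrite big1 // => j _.
    by rewrite mxE /nsq /= expr0n addr0 mulr0.
  by rewrite mulr0 mulr_ge0 ?divr_ge0 // ltW.
apply: h2; have := trnorm_sqr_le (rho_avg rho - sigma) q0 (spectrum_sum ds')
  (spectralmx_adj_mulmx s).
move: h; rewrite /Dtr trnorm_real.
have -> : (2^-1 : C) = ((2^-1 : R)%:C)%C by rewrite -(real_complex_nat R 2) fmorphV.
rewrite -real_complexM ltcR.
set t := complex.Re _ => h hB.
have : (2 * eps) ^+ 2 < t ^+ 2.
  by rewrite ltr_sqr ?nnegrE ?mulr_ge0 ?(ltW e0) //; lra.
lra.
Qed.

End Chi2Test.

Theorem theorem2p4 (R : realType) :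
  exists K : R, 0 < K /\
  forall (d : nat) (sigma : 'M[R[i]]_d) (gamma : R),
    density sigma ->
    (* gamma is the minimum eigenvalue of sigma *)
    eigenvalue sigma (gamma%:C)%C ->
    (forall a, eigenvalue sigma a -> (gamma%:C)%C <= a) ->
    (* (i) chi^2 testing *)
    (forall (theta : R) (T : nat),
       0 < theta -> 0 < gamma ->
       K * Num.max (d%:R / theta)
                   (Num.sqrt (d%:R) / Num.sqrt (theta * gamma)) <= T%:R ->
       exists E : 'M[R[i]]_(tens_dim T d), effect E /\
         forall rho : 'I_T -> 'M[R[i]]_d, (forall t, density (rho t)) ->
           (chi2 (rho_avg rho) sigma <= ((99/100 * theta)%:C)%C ->
              99/100 <= accept_prob E (tens_state rho)) /\
           ((theta%:C)%C < chi2 (rho_avg rho) sigma ->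
              accept_prob E (tens_state rho) <= 1/100)) /\
    (* (ii) trace-distance identity testing *)
    (forall (eps : R) (T : nat),
       0 < eps ->
       K * (d%:R / eps ^+ 2) <= T%:R ->
       exists E : 'M[R[i]]_(tens_dim T d), effect E /\
         forall rho : 'I_T -> 'M[R[i]]_d, (forall t, density (rho t)) ->
           (rho_avg rho = sigma ->
              99/100 <= accept_prob E (tens_state rho)) /\
           ((eps%:C)%C < Dtr (rho_avg rho) sigma ->
              accept_prob E (tens_state rho) <= 1/100)).
Proof.
have K0 : 0 < 10 ^+ 10 :> R by rewrite exprn_gt0.
(* The factor 2 is spent in the trace-distance test; the chi-square test runs at [10 ^+ 10]. *)
exists (2 * 10 ^+ 10); split; first by rewrite mulr_gt0.
move=> d sigma gamma ds _ hmin; have d0 := density_dim_gt0 ds.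
have d0R : 0 < d%:R :> R by rewrite ltr0n.
have K2 : 0 < 2 * 10 ^+ 10 :> R by rewrite mulr_gt0.
split=> [theta T th0 g0 hT | eps T e0 hT]; last first.
  apply: trace_distance_test => //; rewrite -(ltr0n R).
  by apply: lt_le_trans hT; rewrite mulr_gt0 // divr_gt0 // exprn_gt0.
have m1 : d%:R / theta <= Num.max (d%:R / theta) (Num.sqrt d%:R / Num.sqrt (theta * gamma)).
  by rewrite le_max lexx.
have m2 : Num.sqrt d%:R / Num.sqrt (theta * gamma) <=
          Num.max (d%:R / theta) (Num.sqrt d%:R / Num.sqrt (theta * gamma)).
  by rewrite le_max lexx orbT.
have a0 : 0 < d%:R / theta by rewrite divr_gt0.
have tg0 : 0 < theta * gamma by rewrite mulr_gt0.
have r0 : 0 <= Num.sqrt d%:R / Num.sqrt (theta * gamma) by rewrite divr_ge0 ?sqrtr_ge0.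
have h1 : 2 * 10 ^+ 10 * (d%:R / theta) <= T%:R.
  by apply: le_trans hT; rewrite ler_pM2l.
have h2 : 2 * 10 ^+ 10 * (Num.sqrt d%:R / Num.sqrt (theta * gamma)) <= T%:R.
  by apply: le_trans hT; rewrite ler_pM2l.
have K12 : 10 ^+ 10 <= 2 * 10 ^+ 10 :> R by rewrite ler_peMl ?(ltW K0) // ler1n.
apply: (@chi2_test _ _ _ ds _ gamma) => //.
- move=> i; have := hmin _ (spectral_diag_eigenvalue i (density_herm ds)).
  by rewrite (spectrumE ds) lecR.
- by rewrite -(ltr0n R); apply: lt_le_trans h1; rewrite mulr_gt0.
- by apply: le_trans h1; rewrite ler_pM2r.
(* [chi2_test] takes its second requirement squared, which removes the square roots. *)
have -> : d%:R / (theta * gamma) = (Num.sqrt d%:R / Num.sqrt (theta * gamma)) ^+ 2.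
  by rewrite expr_div_n !sqr_sqrtr // ltW.
rewrite -exprMn ler_sqr ?nnegrE ?ler0n //; last by rewrite mulr_ge0 // ltW.
by apply: le_trans h2; rewrite ler_wpM2r.
Qed.
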